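(* Let $\mathbb{A}=L_a\mathbb{I}+D_a\mathbf{A}$, $\mathbb{B}=L_b\mathbb{I}+D_b\mathbf{B}$, $\mathbb{Q}=L_q\mathbb{I}+D_q\mathbf{Q}$ and $\mathbb{Q}_T=L_{q_T}\mathbb{I}+D_{q_T}\mathbf{Q}_T$, where $L_a,D_a,L_b,D_b,L_q,D_q,L_{q_T},D_{q_T}\in\mathbb{R}^{n\times n}$ and $\mathbf{A},\mathbf{B},\mathbf{Q},\mathbf{Q}_T\in\mathcal{W}_c$. Assume: (1) $\mathbb{Q}$ and $\mathbb{Q}_T$ are self-adjoint and non-negative on $(L^2[0,1])^n$; (2) there is a finite-dimensional subspace $\mathcal{S}\subset L^2[0,1]$ that is invariant under each of $\mathbf{A},\mathbf{B},\mathbf{Q},\mathbf{Q}_T$; (3) $\mathbf{A}\mathbf{v}=\mathbf{B}\mathbf{v}=\mathbf{Q}\mathbf{v}=\mathbf{Q}_T\mathbf{v}=0$ for all $\mathbf{v}\in\mathcal{S}^\perp$. Let $d=\dim\mathcal{S}$, let $\mathbf{f}_1,\dots,\mathbf{f}_d$ be an orthonormal basis of $\mathcal{S}$, and let $A,B,Q,Q_T\in\mathbb{R}^{d\times d}$ have entries $A_{\ell k}=\langle\mathbf{A}\mathbf{f}_\ell,\mathbf{f}_k\rangle$, $B_{\ell k}=\langle\mathbf{B}\mathbf{f}_\ell,\mathbf{f}_k\rangle$, $Q_{\ell k}=\langle\mathbf{Q}\mathbf{f}_\ell,\mathbf{f}_k\rangle$, $(Q_T)_{\ell k}=\langle\mathbf{Q}_T\mathbf{f}_\ell,\mathbf{f}_k\rangle$.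 Fix $\mathbf{x}_0\in(L^2[0,1])^n$. Consider the original problem: minimize $$J(\mathbf{u})=\int_0^T\big(\langle\mathbf{x}_t,\mathbb{Q}\mathbf{x}_t\rangle+\langle\mathbf{u}_t,\mathbf{u}_t\rangle\big)dt+\langle\mathbf{x}_T,\mathbb{Q}_T\mathbf{x}_T\rangle$$ over $\mathbf{u}\in L^2([0,T];(L^2[0,1])^n)$ subject to $\dot{\mathbf{x}}_t=\mathbb{A}\mathbf{x}_t+\mathbb{B}\mathbf{u}_t$, $t\in[0,T]$, with initial state $\mathbf{x}_0$. For a control $\mathbf{u}$ with state $\mathbf{x}$ put $x_t^p=\mathrm{Proj}_{\mathbf{f}}(\mathbf{x}_t)$, $u_t^p=\mathrm{Proj}_{\mathbf{f}}(\mathbf{u}_t)\in\mathbb{R}^{nd}$, and $\breve{\mathbf{x}}_t^\gamma=\breve{\mathbf{x}}_t(\gamma)$, $\breve{\mathbf{u}}_t^\gamma=\breve{\mathbf{u}}_t(\gamma)\in\mathbb{R}^n$. Then the original problem is transformed into the following equivalent problem. The dynamics become $$\dot x_t^p=(I\otimes L_a+A\otimes D_a)x_t^p+(I\otimes L_b+B\otimes D_b)u_t^p,$$ $$\dot{\breve{\mathbf{x}}}_t^\gamma=L_a\breve{\mathbf{x}}_t^\gamma+L_b\breve{\mathbf{u}}_t^\gamma\quad\text{for almost all }\gamma\in[0,1],$$ with initial conditions $x_0^p=\mathrm{Proj}_{\mathbf{f}}(\mathbf{x}_0)$ and $\breve{\mathbf{x}}_0^\gamma=\mathbf{x}_0(\gamma)-\sum_{\ell=1}^d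 x_0^{p\ell}\,\mathbf{f}_\ell(\gamma)$; and $\mathbf{u}$ minimizes $J$ if and only if $u^p$ minimizes $$J_{\mathcal{S}}(u^p)=\int_0^T\Big((x_t^p)^\top(I\otimes L_q+Q\otimes D_q)x_t^p+(u_t^p)^\top u_t^p\Big)dt+(x_T^p)^\top(I\otimes L_{q_T}+Q_T\otimes D_{q_T})x_T^p$$ subject to the first equation and, for almost all $\gamma\in[0,1]$, $\breve{\mathbf{u}}^\gamma$ minimizes $$J_{\mathcal{S}^\perp}(\breve{\mathbf{u}}^\gamma)=\int_0^T\Big((\breve{\mathbf{x}}_t^\gamma)^\top L_q\breve{\mathbf{x}}_t^\gamma+(\breve{\mathbf{u}}_t^\gamma)^\top\breve{\mathbf{u}}_t^\gamma\Big)dt+(\breve{\mathbf{x}}_T^\gamma)^\top L_{q_T}\breve{\mathbf{x}}_T^\gamma$$ subject to the second equation (minimizations over $L^2([0,T];\mathbb{R}^{nd})$ and $L^2([0,T];\mathbb{R}^{n})$ respectively, with the stated initial conditions).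
   Context: Fix $T>0$, $c>0$, $n\ge1$. $\mathcal{W}_c$ is the set of symmetric measurable functions $[0,1]^2\to[-c,c]$ (''graphons''). Each $\mathbf{A}\in\mathcal{W}_c$ also denotes the integral operator $(\mathbf{A}\mathbf{v})(\alpha)=\int_0^1\mathbf{A}(\alpha,\beta)\mathbf{v}(\beta)d\beta$ on $L^2[0,1]$. $(L^2[0,1])^n$ is the Hilbert space of real vector functions $\mathbf{v}=(\mathbf{v}_1,\dots,\mathbf{v}_n)$ with inner product $\langle\mathbf{u},\mathbf{v}\rangle=\sum_{i=1}^n\langle\mathbf{u}_i,\mathbf{v}_i\rangle_{L^2[0,1]}$. For $D\in\mathbb{R}^{n\times n}$, $D\mathbf{A}$ and $D\mathbb{I}$ are the bounded operators on $(L^2[0,1])^n$ given by $([D\mathbf{A}]\mathbf{v})(\alpha)=D\int_0^1\mathbf{A}(\alpha,\beta)\mathbf{v}(\beta)d\beta$ and $([D\mathbb{I}]\mathbf{v})(\alpha)=D\mathbf{v}(\alpha)$. All linear controlled differential equations are understood in the mild (variation of constants) sense: $\mathbf{x}_t=e^{(t-a)\mathbb{A}}\mathbf{x}_a+\int_a^te^{(t-s)\mathbb{A}}\mathbb{B}\mathbf{u}_s\,ds$ for all $0\le a\le t\le T$. Elements of $L^2([0,T];(L^2[0,1])^n)$ are identified with jointly measurable functions of $(t,\gamma)\in[0,T]\times[0,1]$, so that for almost all $\gamma$ the function $t\mapsto\breve{\mathbf{u}}_t(\gamma)$ is in $L^2([0,T];\mathbb{R}^n)$. A subspace $\mathcal{S}$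 is invariant under $\mathbf{A}$ if $\mathbf{A}\mathbf{v}\in\mathcal{S}$ for all $\mathbf{v}\in\mathcal{S}$. $(\mathcal{S})^n=\mathcal{S}\times\cdots\times\mathcal{S}$ ($n$ factors), and likewise $(\mathcal{S}^\perp)^n$. Every $\mathbf{v}\in(L^2[0,1])^n$ is decomposed uniquely, component by component, as $\mathbf{v}=\mathbf{v}^{\mathbf{f}}+\breve{\mathbf{v}}$ with $\mathbf{v}^{\mathbf{f}}\in(\mathcal{S})^n$, $\breve{\mathbf{v}}\in(\mathcal{S}^\perp)^n$. For $\mathbf{x}\in(L^2[0,1])^n$, $\mathrm{Proj}_{\mathbf{f}}(\mathbf{x})=[(x^{p1})^\top,\dots,(x^{pd})^\top]^\top\in\mathbb{R}^{nd}$, where $x^{p\ell}\in\mathbb{R}^n$ has $i$-th entry $\langle\mathbf{x}_i,\mathbf{f}_\ell\rangle$. $\otimes$ is the Kronecker product $M\otimes D=[m_{ij}D]_{ij}$, and $I$ is the $d\times d$ identity matrix. *)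

(* Defs.v *)
(* Elements of L^2[0,1] and of L^2([0,T]; L^2[0,1]^n) are
   represented by measurable functions on R and on R * R, taken up to equality
   almost everywhere for the Lebesgue measure carried by [0,1] and by
   [0,T] * [0,1]; values outside these sets play no role.  R^{nd} is
   'cV_(d * n): d blocks of size n, the block order of the Kronecker product
   *t of mxtens. *)
From HB Require Import structures.
From mathcomp Require Import all_boot all_order all_algebra.
From mathcomp Require Import all_classical all_reals all_analysis.
From mathcomp Require Export mxtens.

Set Implicit Arguments.
Unset Strict Implicit.
Unset Printing Implicit Defensive.

Import Order.TTheory GRing.Theory Num.Theory.
Import numFieldNormedType.Exports.

Local Open Scope classical_set_scope.
Local Open Scope ring_scope.

(* Lebesgue measure carried by [a, b] (the zero measure if b < a). *)
Definition leb (R : realType) (a b : R) : set (measurableTypeR R) -> \bar R :=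
  mrestr (@lebesgue_measure R) (measurable_itv `[a, b]).

HB.instance Definition _ (R : realType) (a b : R) := Measure.on (@leb R a b).

Lemma leb_fin (R : realType) (a b : R) : fin_num_fun (@leb R a b).
Proof.
move=> U mU; rewrite ge0_fin_numE //.
apply: (@le_lt_trans _ _ (@lebesgue_measure R `[a, b]%classic)).
  by apply: le_measure; rewrite ?inE //; exact: measurableI.
by rewrite /= lebesgue_measure_itv; case: ifP => _ //; rewrite -EFinB ltry.
Qed.

HB.instance Definition _ (R : realType) (a b : R) :=
  Measure_isFinite.Build _ _ _ (@leb R a b) (leb_fin a b).

Definition L2 (R : realType) (f : R -> R) : Prop := f \in Lfun (leb 0 1) 2%:E.

Definition L2v (R : realType) n (v : R -> 'cV[R]_n) : Prop :=
  forall i, L2 (fun a => v a i 0).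

Definition ip (R : realType) (f g : R -> R) : R :=
  \int[leb 0 1]_a (f a * g a).

Definition ipv (R : realType) n (u v : R -> 'cV[R]_n) : R :=
  \sum_(i < n) ip (fun a => u a i 0) (fun a => v a i 0).

(* L^2([0,T]; R^m) *)
Definition L2t (R : realType) (T : R) m (u : R -> 'cV[R]_m) : Prop :=
  forall i, (fun t => u t i 0) \in Lfun (leb 0 T) 2%:E.

(* L^2([0,T]; (L^2[0,1])^n), as jointly measurable functions of (t, gamma) *)
Definition L2tv (R : realType) (T : R) n (u : R -> R -> 'cV[R]_n) : Prop :=
  forall i, (fun p : measurableTypeR R * measurableTypeR R => u p.1 p.2 i 0) \in
    Lfun (leb 0 T \x leb 0 1)%E 2%:E.

Definition graphon (R : realType) (c : R) (W : R -> R -> R) : Prop :=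
  [/\ measurable_fun setT
        (fun p : measurableTypeR R * measurableTypeR R => W p.1 p.2),
      {in `[0, 1] &, forall a b, W a b = W b a} &
      {in `[0, 1] &, forall a b, `|W a b| <= c}].

Definition gop (R : realType) (W : R -> R -> R) (v : R -> R) : R -> R :=
  fun a => \int[leb 0 1]_b (W a b * v b).

(* L I + D W on (L^2[0,1])^n *)
Definition vop (R : realType) n (L D : 'M[R]_n) (W : R -> R -> R)
    (v : R -> 'cV[R]_n) : R -> 'cV[R]_n :=
  fun a => L *m v a + D *m \col_i gop W (fun b => v b i 0) a.

Definition self_adjoint (R : realType) n
    (A : (R -> 'cV[R]_n) -> (R -> 'cV[R]_n)) : Prop :=
  forall u v, L2v u -> L2v v -> ipv (A u) v = ipv u (A v).

Definition non_negative (R : realType) n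
    (A : (R -> 'cV[R]_n) -> (R -> 'cV[R]_n)) : Prop :=
  forall v, L2v v -> 0 <= ipv v (A v).

Definition L2_subspace (R : realType) (S : set (R -> R)) : Prop :=
  [/\ forall f, S f -> L2 f,
      forall f g, S f -> L2 g -> {ae leb 0 1, forall a, f a = g a} -> S g,
      S (fun=> 0) &
      forall (k : R) f g, S f -> S g -> S (fun a => k * f a + g a)].

Definition orthogonal_complement (R : realType) (S : set (R -> R)) :
    set (R -> R) :=
  [set v | L2 v /\ forall g, S g -> ip v g = 0].

Definition is_basis (R : realType) (S : set (R -> R)) d
    (f : 'I_d -> R -> R) : Prop :=
  [/\ forall l, S (f l),
      forall k : 'I_d -> R,
        {ae leb 0 1, forall a, \sum_l k l * f l a = 0} -> forall l, k l = 0 &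
      forall v, S v -> exists k : 'I_d -> R,
        {ae leb 0 1, forall a, v a = \sum_l k l * f l a}].

Definition orthonormal_basis (R : realType) (S : set (R -> R)) d
    (f : 'I_d -> R -> R) : Prop :=
  is_basis S f /\ forall l k, ip (f l) (f k) = (l == k)%:R.

Definition invariant_under (R : realType) (S : set (R -> R)) (W : R -> R -> R) :
    Prop :=
  forall v, S v -> S (gop W v).

(* w is the (S^perp)^n-component of v. *)
Definition breve_part (R : realType) n (S : set (R -> R))
    (v w : R -> 'cV[R]_n) : Prop :=
  forall i, S (fun a => v a i 0 - w a i 0) /\
            orthogonal_complement S (fun a => w a i 0).

Definition Projf (R : realType) d n (f : 'I_d -> R -> R)
    (v : R -> 'cV[R]_n) : 'cV[R]_(d * n) :=
  \col_k ip (fun a => v a (mxtens_unindex k).2 0) (f (mxtens_unindex k).1).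

Definition gmat (R : realType) d (f : 'I_d -> R -> R) (W : R -> R -> R) :
    'M[R]_d :=
  \matrix_(l, k) ip (gop W (f l)) (f k).

(* gamma |-> v(gamma) - \sum_l v^{pl} f_l(gamma) *)
Definition residual (R : realType) d n (f : 'I_d -> R -> R)
    (v : R -> 'cV[R]_n) (a : R) : 'cV[R]_n :=
  v a - \sum_(l < d) f l a *: \col_i ip (fun b => v b i 0) (f l).

Definition is_expop (R : realType) n
    (A : (R -> 'cV[R]_n) -> (R -> 'cV[R]_n)) (t : R) (v w : R -> 'cV[R]_n) :
    Prop :=
  let r N a := \sum_(k < N) (t ^+ k / k`!%:R) *: iter k A v a - w a in
  L2v w /\ (fun N => Num.sqrt (ipv (r N) (r N))) @ \oo --> 0.

(* e^{tA} v, the limit in (L^2[0,1])^n of the exponential series at v; it is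
   only determined almost everywhere *)
Definition expop (R : realType) n
    (A : (R -> 'cV[R]_n) -> (R -> 'cV[R]_n)) (t : R) (v : R -> 'cV[R]_n) :
    R -> 'cV[R]_n :=
  xget (fun=> 0) [set w | is_expop A t v w].

(* x is the mild solution of x' = A x + B u, x(0) = x0, in (L^2[0,1])^n.  The
   (L^2[0,1])^n-valued integral is the one characterized by its inner products
   with all phi. *)
Definition state_op (R : realType) (T : R) n
    (A B : (R -> 'cV[R]_n) -> (R -> 'cV[R]_n)) (x0 : R -> 'cV[R]_n)
    (u x : R -> R -> 'cV[R]_n) : Prop :=
  [/\ forall t, 0 <= t <= T -> L2v (x t),
      {ae leb 0 1, forall a, x 0 a = x0 a} &
      forall a t, 0 <= a -> a <= t -> t <= T -> forall phi, L2v phi ->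
        ipv (x t) phi = ipv (expop A (t - a) (x a)) phi +
          \int[@lebesgue_measure R]_(s in `[a, t]) ipv (expop A (t - s) (B (u s))) phi].

Definition expmx (R : realType) m (M : 'M[R]_m) (t : R) : 'M[R]_m :=
  \matrix_(i, j)
    limn (fun N => \sum_(k < N) (t ^+ k / k`!%:R) * (M ^+ k) i j).

(* x is the mild solution of x' = M x + N u, x(0) = x0, in R^m. *)
Definition state_mx (R : realType) (T : R) m (M N : 'M[R]_m) (x0 : 'cV[R]_m)
    (u x : R -> 'cV[R]_m) : Prop :=
  x 0 = x0 /\
  forall a t, 0 <= a -> a <= t -> t <= T ->
    x t = expmx M (t - a) *m x a +
      \col_i \int[@lebesgue_measure R]_(s in `[a, t]) (expmx M (t - s) *m (N *m u s)) i 0.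

Definition cost_op (R : realType) (T : R) n
    (Q QT : (R -> 'cV[R]_n) -> (R -> 'cV[R]_n)) (u x : R -> R -> 'cV[R]_n) :
    R :=
  \int[@lebesgue_measure R]_(t in `[0, T]) (ipv (x t) (Q (x t)) + ipv (u t) (u t)) +
  ipv (x T) (QT (x T)).

Definition cost_mx (R : realType) (T : R) m (Q QT : 'M[R]_m)
    (u x : R -> 'cV[R]_m) : R :=
  \int[@lebesgue_measure R]_(t in `[0, T]) (((x t)^T *m Q *m x t) 0 0 + ((u t)^T *m u t) 0 0) +
  ((x T)^T *m QT *m x T) 0 0.

Definition minimizes_op (R : realType) (T : R) n
    (A B Q QT : (R -> 'cV[R]_n) -> (R -> 'cV[R]_n)) (x0 : R -> 'cV[R]_n)
    (u : R -> R -> 'cV[R]_n) : Prop :=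
  L2tv T u /\ exists2 x, state_op T A B x0 u x &
    forall u' x', L2tv T u' -> state_op T A B x0 u' x' ->
      cost_op T Q QT u x <= cost_op T Q QT u' x'.

Definition minimizes_mx (R : realType) (T : R) m (M N Q QT : 'M[R]_m)
    (x0 : 'cV[R]_m) (u : R -> 'cV[R]_m) : Prop :=
  L2t T u /\ exists2 x, state_mx T M N x0 u x &
    forall u' x', L2t T u' -> state_mx T M N x0 u' x' ->
      cost_mx T Q QT u x <= cost_mx T Q QT u' x'.

(* Main.v *)
(* In the coordinates (Projf v, residual v), relative to S and its complement,
   L I + D W acts as the pair (I (x) L + W (x) D, L), because W preserves S and
   kills the complement.  The operator exponential therefore splits, the weak
   mild equation becomes a mild equation in R^{nd} together with, for almost
   every gamma, a mild equation in R^n (Fubini), and J(u) is J_S(u^p) plus the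
   integral over gamma of J_{S^perp}(ub^gamma).  The two summands involve
   independent controls, which gives one implication and the optimality of u^p.
   For the optimality of almost every ub^gamma, let G be the L^2-gradient of
   J_{S^perp} at ub^gamma.  It is jointly measurable with values in S^perp, so
   u - e G is admissible for every e, and comparing the costs as e -> 0+ yields
   that the integral of |G|^2 vanishes; since L_q and L_{q_T} are non-negative,
   the cost is convex and a vanishing gradient is sufficient. *)
From HB Require Import structures.
Require Import Defs.
From mathcomp Require Import all_boot all_order all_algebra.
From mathcomp Require Import all_classical all_reals all_analysis.
From mathcomp Require Import measurable_realfun ring lra.

Set Implicit Arguments.
Unset Strict Implicit.
Unset Printing Implicit Defensive.

Import Order.TTheory GRing.Theory Num.Theory.
Import numFieldNormedType.Exports.

Local Open Scope classical_set_scope.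
Local Open Scope ring_scope.

(** The obstacle is the choice of representatives. A state is a family of classes, one for each t,
    with no joint measurability in t and gamma, and its exceptional set of gamma may depend on t;
    the pointwise equations require one null set of gamma that serves all t. [expop] is likewise an
    unspecified representative. Every jointly measurable object is therefore built from explicit
    Duhamel kernels acting in time, bounded and measurable on the whole plane. The weak equation
    serves only to identify the given state with the explicit one, separately at each t, and
    integrals over t are compared through almost everywhere equality of integrands, without asking
    that the original integrand be measurable. A second point is that the cost is an exact quadratic
    polynomial along every line of controls, and that its linear term is computed by Fubini from the
    transposed kernel. No differentiability theory and no dominated convergence in the control
    enters. *)

(** * Integrals of functions that may fail to be measurable *)

Section NonmeasurableIntegrands.
Context d (X : measurableType d) (R : realType).
Implicit Type mu : {measure set X -> \bar R}.
Import HBNNSimple.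
Local Open Scope ereal_scope.

(* [integral] is a supremum over simple functions, so these hold without any
   measurability of the integrands; [expop] is only specified almost everywhere
   and may produce non-measurable representatives. *)
Lemma ae_le_ge0_integral_gen mu (f g : X -> \bar R) :
  (forall x, 0 <= f x) -> (forall x, 0 <= g x) ->
  {ae mu, forall x, f x <= g x} -> \int[mu]_x f x <= \int[mu]_x g x.
Proof.
move=> f0 g0 [N [mN muN fgN]]; rewrite !ge0_integralTE//.
apply: ge_ereal_sup => _ [h /= hf <-].
have mNC : measurable (~` N) by exact: measurableC.
have hN x : proj_nnsfun h mNC x = (h \_ (~` N)) x by rewrite mrestrict.
(* Cut off on the null set [N], the simple function [h] lies below [g] everywhere and keeps its
   integral. *)
apply: le_ereal_sup_tmp; exists (sintegral mu (proj_nnsfun h mNC)).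
  exists (proj_nnsfun h mNC) => // x.
  rewrite hN patchE; case: ifPn => xN //.
  rewrite (le_trans (hf x))//; apply: contrapT => fg.
  by move: xN; rewrite inE; apply; exact: fgN.
rewrite -!integralT_nnsfun (ge0_negligible_integral mN measurableT)//.
- rewrite [leRHS](ge0_negligible_integral mN measurableT)//.
  + rewrite le_eqVlt; apply/orP; left; apply/eqP/eq_integral => x.
    by rewrite setTD => Nx; rewrite hN patchE Nx.
  + exact/measurable_EFinP.
  + by move=> x _; rewrite lee_fin.
- exact/measurable_EFinP.
- by move=> x _; rewrite lee_fin.
Qed.

Lemma ae_eq_integral_gen mu (f g : X -> \bar R) :
  {ae mu, forall x, f x = g x} -> \int[mu]_x f x = \int[mu]_x g x.
Proof.
move=> fg; rewrite integralE [RHS]integralE.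
congr (_ - _); apply/eqP; rewrite eq_le; apply/andP; split;
  apply: ae_le_ge0_integral_gen => //; apply: filterS fg => x fg;
  by rewrite ?(funeposE, funenegE) ?/funepos ?/funeneg /= fg.
Qed.

Lemma integral_mrestr mu (D : set X) (mD : measurable D) (f : X -> \bar R) :
  \int[mrestr mu mD]_x f x = \int[mu]_(x in D) f x.
Proof.
have sint (h : {nnsfun X >-> R}) :
    sintegral (mrestr mu mD) h = sintegral mu (proj_nnsfun h mD).
  rewrite /sintegral; apply: eq_fsbigr => r _.
  (* The cut-off function is also 0 off [D], so the level sets correspond only for nonzero
     values. *)
  have [->|r0] := eqVneq r 0%R; first by rewrite !mul0e.
  congr (_ * _); rewrite /mrestr; congr (mu _); rewrite -mrestrict.
  apply/seteqP; split=> [x [<- Dx]|x] /=; first by rewrite patchE mem_set.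
  rewrite patchE; case: ifPn => [/set_mem Dx <- //|_ /esym /eqP].
  by rewrite (negbTE r0).
have ge0 (g : X -> \bar R) : (forall x, 0 <= g x) ->
    \int[mrestr mu mD]_x g x = \int[mu]_(x in D) g x.
  move=> g0; have gD0 x : 0 <= (g \_ D) x by rewrite patchE; case: ifP.
  rewrite integral_mkcond !ge0_integralTE//; apply/eqP.
  rewrite eq_le; apply/andP; split; apply: ge_ereal_sup => _ [h /= hg <-];
    apply: ereal_sup_ubound; exists (proj_nnsfun h mD).
  - move=> x; rewrite -mrestrict !patchE; case: ifPn => // _; exact: hg.
  - by rewrite sint.
  - move=> x; rewrite -mrestrict patchE; case: ifPn => [xD|_]; last first.
      by have := hg x; rewrite patchE; case: ifP => // _; exact: le_trans.
    by rewrite (le_trans (hg x))// patchE xD.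
  - rewrite sint; congr sintegral; rewrite -!mrestrict; apply/funext => x.
    rewrite !patchE; have [xD|xD] := boolP (x \in D) => //.
    have := hg x; rewrite patchE (negbTE xD) lee_fin => hx.
    by apply/eqP; rewrite eq_le hx andbT fun_ge0.
rewrite [LHS](@integralE _ _ R) (@integralE _ _ R mu D f).
by congr (_ - _)%E; apply: ge0.
Qed.

End NonmeasurableIntegrands.

(** * Square-integrable functions *)

Section RealIntegral.
Context d (X : measurableType d) (R : realType).
Variable mu : {measure set X -> \bar R}.

Lemma ae_eq_Rintegral (f g : X -> R) :
  {ae mu, forall x, f x = g x} -> \int[mu]_x f x = \int[mu]_x g x.
Proof.
by move=> fg; congr fine; apply: ae_eq_integral_gen; apply: filterS fg => x ->.
Qed.

Definition integ (f : X -> R) := mu.-integrable setT (EFin \o f).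

Lemma integD f g : integ f -> integ g -> integ (fun x => f x + g x).
Proof. by move=> fi gi; exact: (integrableD measurableT fi gi). Qed.

Lemma integZ k f : integ f -> integ (fun x => k * f x).
Proof. by move=> fi; exact: (@integrableZl _ _ _ mu _ measurableT k (EFin \o f)). Qed.

Lemma integN f : integ f -> integ (fun x => - f x).
Proof. by move=> fi; exact: (integrableN fi). Qed.

Lemma integB f g : integ f -> integ g -> integ (fun x => f x - g x).
Proof. by move=> fi gi; apply: integD => //; exact: integN. Qed.

Lemma integ0 : integ (fun=> 0).
Proof. exact: integrable0. Qed.

Lemma integ_sum I (s : seq I) (F : I -> X -> R) :
  (forall i, integ (F i)) -> integ (fun x => \sum_(i <- s) F i x).
Proof.
move=> Fi; elim: s => [|i s IH].
  by under eq_fun do rewrite big_nil; exact: integ0.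
by under eq_fun do rewrite big_cons; exact: integD.
Qed.

Lemma integ_measurable f : integ f -> measurable_fun setT f.
Proof. by move=> /measurable_int /measurable_EFinP. Qed.

Lemma Rintegral_sum I (s : seq I) (F : I -> X -> R) :
  (forall i, integ (F i)) ->
  \int[mu]_x (\sum_(i <- s) F i x) = \sum_(i <- s) \int[mu]_x F i x.
Proof.
move=> Fi; elim: s => [|i s IH].
  by under eq_Rintegral do rewrite big_nil; rewrite big_nil /Rintegral integral0.
under eq_Rintegral do rewrite big_cons.
rewrite RintegralD//; [by rewrite big_cons IH|exact: Fi|exact: integ_sum].
Qed.

Lemma integ_le (f g : X -> R) : measurable_fun setT f -> integ g ->
  (forall x, `|f x| <= g x) -> integ f.
Proof.
move=> mf gi fg; apply: (le_integrable measurableT _ _ gi).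
  exact/measurable_EFinP.
by move=> x _ /=; rewrite lee_fin (le_trans (fg x))// ler_norm.
Qed.

(** The same as membership in [Lfun mu 2%:E] ([Lfun2P]), but phrased with real squares, so that
    closure properties follow from polynomial inequalities. *)
Definition l2 (f : X -> R) :=
  measurable_fun setT f /\ integ (fun x => f x ^+ 2).

Lemma l2M f g : l2 f -> l2 g -> integ (fun x => f x * g x).
Proof.
move=> [mf fi] [mg gi]; apply: (integ_le _ (integD fi gi)) => [|x].
  exact: measurable_funM.
rewrite normrM -(real_normK (num_real (f x))) -(real_normK (num_real (g x))).
by nra.
Qed.

Lemma l2Z k f : l2 f -> l2 (fun x => k * f x).
Proof.
move=> [mf fi]; split; first exact: measurable_funM.
by under eq_fun do rewrite exprMn; exact: integZ.
Qed.

Lemma l2D f g : l2 f -> l2 g -> l2 (fun x => f x + g x).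
Proof.
move=> f2 g2; have [mf fi] := f2; have [mg gi] := g2.
split; first exact: measurable_funD.
rewrite (_ : (fun x => _) = (fun x => (f x ^+ 2 + g x ^+ 2) + 2 * (f x * g x))).
  by apply: integD; [exact: integD|apply: integZ; exact: l2M].
by apply/funext => x; ring.
Qed.

Lemma l2N f : l2 f -> l2 (fun x => - f x).
Proof. by move=> /(l2Z (-1)); under eq_fun do rewrite mulN1r. Qed.

Lemma l2B f g : l2 f -> l2 g -> l2 (fun x => f x - g x).
Proof. by move=> f2 g2; apply: l2D => //; exact: l2N. Qed.

Lemma l20 : l2 (fun=> 0).
Proof. by split; [exact: measurable_cst|rewrite expr0n/=; exact: integ0]. Qed.

Lemma l2_sum I (s : seq I) (F : I -> X -> R) :
  (forall i, l2 (F i)) -> l2 (fun x => \sum_(i <- s) F i x).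
Proof.
move=> Fi; elim: s => [|i s IH].
  by under eq_fun do rewrite big_nil; exact: l20.
by under eq_fun do rewrite big_cons; exact: l2D.
Qed.

Lemma l2_bndM (h f : X -> R) C : measurable_fun setT h ->
  (forall x, `|h x| <= C) -> l2 f -> l2 (fun x => h x * f x).
Proof.
move=> mh hC [mf fi]; split; first exact: measurable_funM.
apply: (integ_le _ (integZ (C ^+ 2) fi)) => [|x].
  by apply: measurable_funX; exact: measurable_funM.
rewrite ger0_norm ?sqr_ge0// exprMn ler_wpM2r ?sqr_ge0//.
by rewrite -real_normK ?num_real// lerXn2r// ?nnegrE// (le_trans _ (hC x)).
Qed.

Lemma Lfun2P f : (f \in Lfun mu 2%:E) <-> l2 f.
Proof.
have fE : (\int[mu]_x (`|(EFin \o f) x| `^ 2) = \int[mu]_x `|(f x ^+ 2)%:E|)%E.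
  by apply: eq_integral => x _ /=; rewrite powR_mulrn// normrX.
split.
  rewrite inE => /andP[]; rewrite !inE => /= mf.
  rewrite /finite_norm => nf; split => //.
  apply/integrableP; split; first exact/measurable_EFinP/measurable_funX.
  rewrite /= -fE -(@poweR_Lnorm _ _ _ _ _ 2)//.
  by apply: poweR_lty.
move=> [mf /integrableP[_]] /= nf; rewrite inE/=; apply/andP; split; rewrite inE//=.
rewrite /finite_norm unlock fE; exact: poweR_lty.
Qed.

Lemma l2_eq0 f : l2 f -> \int[mu]_x (f x ^+ 2) = 0 -> {ae mu, forall x, f x = 0}.
Proof.
move=> f2 f20; have /integrableP[mf2 _] := f2.2.
have : (\int[mu]_x `|(f x ^+ 2)%:E| = 0)%E.
  rewrite (eq_integral (fun x => (f x ^+ 2)%:E)); last first.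
    by move=> x _ /=; rewrite ger0_norm// sqr_ge0.
  rewrite -(@fineK _ (integral _ _ _)); first by congr EFin.
  by have /integrable_fin_num := f2.2; apply.
move=> /(ae_eq_integral_abs mu measurableT mf2); apply: filterS => x /(_ I).
by case=> /eqP; rewrite sqrf_eq0 => /eqP.
Qed.

(** Discriminant argument: the quadratic form in (s, t) is the integral of (s f + t g)^2, and its
    value at (b, -c) is b (a b - c^2). This factor can be cancelled only for b > 0. For b = 0 the
    point (c, -a) settles the case a > 0, and the points (1, 1) and (1, -1) the case a = 0. *)
Lemma l2_CS f g : l2 f -> l2 g ->
  (\int[mu]_x (f x * g x)) ^+ 2 <=
  (\int[mu]_x (f x ^+ 2)) * (\int[mu]_x (g x ^+ 2)).
Proof.
move=> f2 g2; set a := \int[mu]_x (f x ^+ 2).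
set b := \int[mu]_x (g x ^+ 2); set c := \int[mu]_x (f x * g x).
have pos s t : 0 <= s ^+ 2 * a + 2 * s * t * c + t ^+ 2 * b.
  have -> : s ^+ 2 * a + 2 * s * t * c + t ^+ 2 * b =
      \int[mu]_x ((s * f x + t * g x) ^+ 2).
    rewrite (eq_Rintegral mu (g := fun x =>
      (s ^+ 2 * f x ^+ 2 + (2 * s * t) * (f x * g x)) + t ^+ 2 * g x ^+ 2)).
      rewrite !RintegralD//; try by repeat apply: integD; apply: integZ;
        (exact: l2M || (by case: f2) || (by case: g2)).
      by rewrite !RintegralZl//; [case: g2|exact: l2M|case: f2].
    by move=> x _; ring.
  by apply: Rintegral_ge0 => x _; exact: sqr_ge0.
have a0 : 0 <= a by apply: Rintegral_ge0 => x _; exact: sqr_ge0.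
have b0 : 0 <= b by apply: Rintegral_ge0 => x _; exact: sqr_ge0.
have [b00|b_neq0] := eqVneq b 0.
  have [a00|a_neq0] := eqVneq a 0.
    have := pos 1 1; have := pos 1 (-1); rewrite b00 a00 => h1 h2.
    have -> : c = 0 by lra.
    by rewrite expr0n mulr0.
  have := pos c (-a); have : 0 < a by rewrite lt0r a_neq0.
  rewrite b00 mulr0 addr0 => a_gt0.
  have -> : c ^+ 2 * a + 2 * c * - a * c = - (a * c ^+ 2) by ring.
  by rewrite oppr_ge0 pmulr_rle0// mulr0.
have := pos b (-c); have : 0 < b by rewrite lt0r b_neq0.
have -> : b ^+ 2 * a + 2 * b * - c * c + (- c) ^+ 2 * b = b * (a * b - c ^+ 2).
  by ring.
by move=> b_gt0; rewrite pmulr_rge0// subr_ge0.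
Qed.

(* [g] is merely measurable: the right-hand side may be +oo. *)
Lemma l2_CSe f g : l2 f -> measurable_fun setT g ->
  (((\int[mu]_x (f x * g x)) ^+ 2)%:E <=
  (\int[mu]_x (f x ^+ 2))%:E * \int[mu]_x (g x ^+ 2)%:E)%E.
Proof.
move=> f2 mg; set a := \int[mu]_x (f x ^+ 2).
have a0 : 0 <= a by apply: Rintegral_ge0 => x _; exact: sqr_ge0.
have b0 : (0 <= \int[mu]_x (g x ^+ 2)%:E)%E.
  by apply: integral_ge0 => x _; rewrite lee_fin sqr_ge0.
case: (ltP (\int[mu]_x (g x ^+ 2)%:E)%E +oo%E) => [gfin|].
  have gi : integ (fun x => g x ^+ 2).
    apply/integrableP; split; first exact/measurable_EFinP/measurable_funX.
    rewrite (eq_integral (fun x => (g x ^+ 2)%:E))// => x _ /=.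
    by rewrite ger0_norm// sqr_ge0.
  have := l2_CS f2 (conj mg gi); rewrite -lee_fin => /le_trans; apply.
  rewrite EFinM /Rintegral (@fineK _ (integral _ _ (fun x => (g x ^+ 2)%:E)))//.
  by rewrite ge0_fin_numE.
rewrite leye_eq => /eqP ->.
move: a0; rewrite le_eqVlt => /predU1P[a0|a0]; last first.
  by rewrite gt0_muley ?leey// lte_fin.
(* Here the right-hand side is 0 * +oo = 0, so the left-hand side must vanish as well; it does
   because [f] is zero almost everywhere. *)
rewrite -a0 mul0e lee_fin.
suff -> : \int[mu]_x (f x * g x) = 0 by rewrite expr0n.
have f0 := l2_eq0 f2 (esym a0).
rewrite (ae_eq_Rintegral (g := fun=> 0)) ?/Rintegral ?integral0//.
by apply: filterS f0 => x ->; rewrite mul0r.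
Qed.

End RealIntegral.

Section Bounded.
Context d (X : measurableType d) (R : realType).
Variable mu : {finite_measure set X -> \bar R}.

Lemma integ_cst k : integ mu (fun=> k).
Proof. exact: finite_measure_integrable_cst. Qed.

Lemma l2_bnd (h : X -> R) C : measurable_fun setT h ->
  (forall x, `|h x| <= C) -> l2 mu h.
Proof.
move=> mh hC; split => //; apply: (integ_le _ (integ_cst (C ^+ 2))) => [|x].
  exact: measurable_funX.
rewrite ger0_norm ?sqr_ge0// -real_normK ?num_real//.
by rewrite lerXn2r// ?nnegrE// (le_trans _ (hC x)).
Qed.

Lemma l2_integ f : l2 mu f -> integ mu f.
Proof.
move=> f2; have one2 : l2 mu (fun=> 1) by apply: (@l2_bnd _ 1) => // x; rewrite normr1.
by have := l2M f2 one2; under eq_fun do rewrite mulr1.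
Qed.

Lemma fin_mass : (mu setT < +oo)%E.
Proof. by rewrite -ge0_fin_numE// fin_num_measure. Qed.

End Bounded.

(** * Product measures: Fubini's theorem and square-integrability of partial integrals *)

Section Product.
Context d1 d2 (X1 : measurableType d1) (X2 : measurableType d2) (R : realType).
Variables (m1 : {finite_measure set X1 -> \bar R})
  (m2 : {finite_measure set X2 -> \bar R}).

(** Tonelli applies to the positive and negative parts; extended subtraction and [fine] are
    measurable, so sections without a finite integral do no harm. *)
Lemma measurable_Rintegral1 (f : X1 * X2 -> R) : measurable_fun setT f ->
  measurable_fun setT (fun x => \int[m2]_y f (x, y)).
Proof.
move=> /measurable_EFinP mf.
apply: (@measurableT_comp _ _ _ _ _ _ fine) => //.
rewrite (_ : (fun x => _) = (fubini_F m2 ((EFin \o f)^\+)%E \-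
                             fubini_F m2 ((EFin \o f)^\-)%E)%E).
  apply: emeasurable_funB; apply: measurable_fun_fubini_tonelli_F => //.
    exact: measurable_funepos.
  exact: measurable_funeneg.
apply/funext => x; rewrite [LHS]integralE.
by congr (_ - _)%E; apply: eq_integral => y _;
  rewrite ?funeposE ?funenegE.
Qed.

Lemma measurable_Rintegral2 (f : X1 * X2 -> R) : measurable_fun setT f ->
  measurable_fun setT (fun y => \int[m1]_x f (x, y)).
Proof.
move=> /measurable_EFinP mf.
apply: (@measurableT_comp _ _ _ _ _ _ fine) => //.
rewrite (_ : (fun x => _) = (fubini_G m1 ((EFin \o f)^\+)%E \-
                             fubini_G m1 ((EFin \o f)^\-)%E)%E).
  apply: emeasurable_funB; apply: measurable_fun_fubini_tonelli_G => //.
    exact: measurable_funepos.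
  exact: measurable_funeneg.
apply/funext => x; rewrite [LHS]integralE.
by congr (_ - _)%E; apply: eq_integral => y _;
  rewrite ?funeposE ?funenegE.
Qed.

Lemma section1_measurable (f : X1 * X2 -> R) x : measurable_fun setT f ->
  measurable_fun setT (fun y => f (x, y)).
Proof. by move=> mf; exact: measurableT_comp. Qed.

Lemma section2_measurable (f : X1 * X2 -> R) y : measurable_fun setT f ->
  measurable_fun setT (fun x => f (x, y)).
Proof. by move=> mf; exact: measurableT_comp. Qed.

Lemma l2_ae_section1 (f : X1 * X2 -> R) : l2 (m1 \x m2)%E f ->
  {ae m1, forall x, l2 m2 (fun y => f (x, y))}.
Proof.
move=> [mf fi]; have := ae_integrable1 fi; apply: filterS => x /= fx.
by split => //; exact: section1_measurable.
Qed.

Lemma l2_ae_section2 (f : X1 * X2 -> R) : l2 (m1 \x m2)%E f ->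
  {ae m2, forall y, l2 m1 (fun x => f (x, y))}.
Proof.
move=> [mf fi]; have := ae_integrable2 fi; apply: filterS => x /= fx.
by split => //; exact: section2_measurable.
Qed.

Section FubiniR.
Variable f : X1 * X2 -> R.
Hypothesis fi : integ (m1 \x m2)%E f.

Lemma EFin_Rintegral1 : {ae m1, forall x,
  ((\int[m2]_y f (x, y))%:E = \int[m2]_y (f (x, y))%:E)%E}.
Proof.
have := ae_integrable1 fi; apply: filterS => x /= fx.
by rewrite fineK//; exact: integrable_fin_num.
Qed.

Lemma EFin_Rintegral2 : {ae m2, forall y,
  ((\int[m1]_x f (x, y))%:E = \int[m1]_x (f (x, y))%:E)%E}.
Proof.
have := ae_integrable2 fi; apply: filterS => x /= fx.
by rewrite fineK//; exact: integrable_fin_num.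
Qed.

Lemma integ_fubini1 : integ m1 (fun x => \int[m2]_y f (x, y)).
Proof.
have /integrable12ltyP fl := fi.
have mF : measurable_fun setT (fun x => \int[m2]_y f (x, y)).
  exact/measurable_Rintegral1/integ_measurable/fi.
apply/integrableP; split; first exact/measurable_EFinP.
apply: (le_lt_trans _ (fl _)); last exact: measurable_int fi.
apply: ae_le_ge0_integral_gen => // [x|]; first exact: integral_ge0.
apply: filterS (ae_integrable1 fi) => x /= fx.
by rewrite EFin_normr_Rintegral//; apply: le_abse_integral => //; exact: measurable_int fx.
Qed.

Lemma integ_fubini2 : integ m2 (fun y => \int[m1]_x f (x, y)).
Proof.
have /integrable21ltyP fl := fi.
have mF : measurable_fun setT (fun y => \int[m1]_x f (x, y)).
  exact/measurable_Rintegral2/integ_measurable/fi.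
apply/integrableP; split; first exact/measurable_EFinP.
apply: (le_lt_trans _ (fl _)); last exact: measurable_int fi.
apply: ae_le_ge0_integral_gen => // [x|]; first exact: integral_ge0.
apply: filterS (ae_integrable2 fi) => x /= fx.
by rewrite EFin_normr_Rintegral//; apply: le_abse_integral => //; exact: measurable_int fx.
Qed.

Lemma Rfubini1 : \int[m1]_x \int[m2]_y f (x, y) = \int[(m1 \x m2)%E]_z f z.
Proof.
congr fine; rewrite -(integral12_prod_meas1 fi).
exact/ae_eq_integral_gen/EFin_Rintegral1.
Qed.

Lemma Rfubini2 : \int[m2]_y \int[m1]_x f (x, y) = \int[(m1 \x m2)%E]_z f z.
Proof.
congr fine; rewrite -(integral21_prod_meas1 fi).
exact/ae_eq_integral_gen/EFin_Rintegral2.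
Qed.

Lemma Rfubini :
  \int[m1]_x \int[m2]_y f (x, y) = \int[m2]_y \int[m1]_x f (x, y).
Proof. by rewrite Rfubini1 Rfubini2. Qed.

End FubiniR.

Lemma l2_tensor (f : X1 -> R) (g : X2 -> R) : l2 m1 f -> l2 m2 g ->
  l2 (m1 \x m2)%E (fun p => f p.1 * g p.2).
Proof.
move=> [mf fi] [mg gi].
have mfg : measurable_fun setT (fun p : X1 * X2 => f p.1 * g p.2).
  by apply: measurable_funM; exact: measurableT_comp.
split => //; apply/integrable12ltyP; first exact/measurable_EFinP/measurable_funX.
under eq_integral => x _.
  under eq_integral => y _.
    rewrite /= exprMn normrM EFinM; over.
  rewrite ge0_integralZl//; last first.
    by apply/measurable_EFinP/measurableT_comp => //; exact: measurable_funX.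
  over.
rewrite /= ge0_integralZr//.
- have /integrableP[_ fl] := fi; have /integrableP[_ gl] := gi.
  rewrite lte_mul_pinfty//; first exact: integral_ge0.
  rewrite ge0_fin_numE//; exact: integral_ge0.
- by apply/measurable_EFinP/measurableT_comp => //; exact: measurable_funX.
- exact: integral_ge0.
Qed.

(** Cauchy-Schwarz in y bounds the square of the partial integral at every x by a constant times the
    integral of f(x, .)^2. That bound may be infinite at exceptional x, which is why [l2_CSe] is
    used; Tonelli shows that it is integrable. *)
Lemma l2_partial1 (f : X1 * X2 -> R) (h : X2 -> R) :
  l2 (m1 \x m2)%E f -> l2 m2 h ->
  l2 m1 (fun x => \int[m2]_y (h y * f (x, y))).
Proof.
move=> [mf fi] h2.
have mF : measurable_fun setT (fun x => \int[m2]_y (h y * f (x, y))).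
  apply: (@measurable_Rintegral1 (fun p => h p.2 * f p)).
  by apply: measurable_funM => //; apply: measurableT_comp => //; case: h2.
split => //; apply/integrableP; split.
  exact/measurable_EFinP/measurable_funX.
set C := \int[m2]_y (h y ^+ 2).
have C0 : 0 <= C by apply: Rintegral_ge0 => x _; exact: sqr_ge0.
have mf2 : measurable_fun setT (fun p => (f p ^+ 2)%:E).
  exact/measurable_EFinP/measurable_funX.
have mf2F : measurable_fun setT (fun x => \int[m2]_y (f (x, y) ^+ 2)%:E)%E.
  apply: (measurable_fun_fubini_tonelli_F (fun p => (f p ^+ 2)%:E)) => // p.
  by rewrite lee_fin sqr_ge0.
apply: (@le_lt_trans _ _ (\int[m1]_x (C%:E * \int[m2]_y (f (x, y) ^+ 2)%:E))%E).
  apply: ge0_le_integral => //.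
  - by apply/measurable_EFinP/measurableT_comp => //; exact: measurable_funX.
  - exact: measurable_funeM.
  - move=> x _ /=; rewrite ger0_norm ?sqr_ge0//.
    by apply: l2_CSe => //; exact: section1_measurable.
rewrite ge0_integralZl//; last first.
  by move=> x _; apply: integral_ge0 => y _; rewrite lee_fin sqr_ge0.
rewrite lte_mul_pinfty//.
have /integrableP[_] := fi; apply: le_lt_trans.
rewrite -(fubini_tonelli1 (fun p => (f p ^+ 2)%:E))//; last first.
  by move=> p; rewrite lee_fin sqr_ge0.
apply: ge0_le_integral => //= [p _||p _]; rewrite ?lee_fin ?sqr_ge0// ?ler_norm//.
by apply/measurable_EFinP/measurableT_comp => //; exact: measurable_funX.
Qed.

Lemma l2_partial2 (f : X1 * X2 -> R) (h : X1 -> R) :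
  l2 (m1 \x m2)%E f -> l2 m1 h ->
  l2 m2 (fun y => \int[m1]_x (h x * f (x, y))).
Proof.
move=> [mf fi] h2.
have mF : measurable_fun setT (fun y => \int[m1]_x (h x * f (x, y))).
  apply: (@measurable_Rintegral2 (fun p => h p.1 * f p)).
  by apply: measurable_funM => //; apply: measurableT_comp => //; case: h2.
split => //; apply/integrableP; split.
  exact/measurable_EFinP/measurable_funX.
set C := \int[m1]_x (h x ^+ 2).
have C0 : 0 <= C by apply: Rintegral_ge0 => x _; exact: sqr_ge0.
have mf2 : measurable_fun setT (fun p => (f p ^+ 2)%:E).
  exact/measurable_EFinP/measurable_funX.
have mf2F : measurable_fun setT (fun y => \int[m1]_x (f (x, y) ^+ 2)%:E)%E.
  apply: (measurable_fun_fubini_tonelli_G (fun p => (f p ^+ 2)%:E)) => // p.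
  by rewrite lee_fin sqr_ge0.
apply: (@le_lt_trans _ _ (\int[m2]_y (C%:E * \int[m1]_x (f (x, y) ^+ 2)%:E))%E).
  apply: ge0_le_integral => //.
  - by apply/measurable_EFinP/measurableT_comp => //; exact: measurable_funX.
  - exact: measurable_funeM.
  - move=> x _ /=; rewrite ger0_norm ?sqr_ge0//.
    by apply: l2_CSe => //; exact: section2_measurable.
rewrite ge0_integralZl//; last first.
  by move=> x _; apply: integral_ge0 => y _; rewrite lee_fin sqr_ge0.
rewrite lte_mul_pinfty//.
have /integrableP[_] := fi; apply: le_lt_trans.
rewrite -(fubini_tonelli2 (fun p => (f p ^+ 2)%:E))//; last first.
  by move=> p; rewrite lee_fin sqr_ge0.
apply: ge0_le_integral => //= [p _||p _]; rewrite ?lee_fin ?sqr_ge0// ?ler_norm//.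
by apply/measurable_EFinP/measurableT_comp => //; exact: measurable_funX.
Qed.

Lemma l2_fubini (f : X1 * X2 -> R) (h : X1 -> R) (k : X2 -> R) :
  l2 (m1 \x m2)%E f -> l2 m1 h -> l2 m2 k ->
  \int[m2]_y (k y * \int[m1]_x (h x * f (x, y))) =
  \int[m1]_x (h x * \int[m2]_y (k y * f (x, y))).
Proof.
move=> f2 h2 k2; have hkf := l2M (l2_tensor h2 k2) f2.
have := Rfubini hkf => /= hk.
transitivity (\int[m2]_y \int[m1]_x (h x * k y * f (x, y))).
  apply: ae_eq_Rintegral; apply: filterS (l2_ae_section2 f2) => y fy.
  rewrite -RintegralZl//; last exact: l2M.
  by apply: eq_Rintegral => x _; ring.
rewrite -hk; apply: ae_eq_Rintegral; apply: filterS (l2_ae_section1 f2) => x fx.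
rewrite -RintegralZl//; last exact: l2M.
by apply: eq_Rintegral => y _; ring.
Qed.

End Product.

Section Kernel.
Context d0 d1 d2 (X0 : measurableType d0) (X1 : measurableType d1)
  (X2 : measurableType d2) (R : realType).
Variables (m0 : {finite_measure set X0 -> \bar R})
  (m1 : {finite_measure set X1 -> \bar R})
  (m2 : {finite_measure set X2 -> \bar R}).

(** Cauchy-Schwarz in the middle variable gives a bound that no longer depends on the first
    variable, so integrating it over [m0] only costs a finite factor. *)
Lemma l2_kernel (q : X0 * X1 -> R) C (f : X1 * X2 -> R) :
  measurable_fun setT q -> (forall p, `|q p| <= C) -> l2 (m1 \x m2)%E f ->
  l2 (m0 \x m2)%E (fun p => \int[m1]_x (q (p.1, x) * f (x, p.2))).
Proof.
move=> mq qC [mf fi].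
have mF : measurable_fun setT
    (fun p : X0 * X2 => \int[m1]_x (q (p.1, x) * f (x, p.2))).
  apply: (@measurable_Rintegral1 _ _ (X0 * X2)%type X1 _ m1
    (fun z => q (z.1.1, z.2) * f (z.2, z.1.2))).
  apply: measurable_funM; apply: measurableT_comp => //.
  - by apply: measurable_fun_pair => //; exact: measurableT_comp.
  - by apply: measurable_fun_pair => //; exact: measurableT_comp.
split => //; apply/integrableP; split.
  exact/measurable_EFinP/measurable_funX.
(* Bounds the integral of q(x0, .)^2 uniformly in x0. *)
pose D := C ^+ 2 * fine (m1 setT).
have D0 : 0 <= D by rewrite mulr_ge0 ?sqr_ge0// fine_ge0.
have qD x0 : \int[m1]_x (q (x0, x) ^+ 2) <= D.
  rewrite /D -(Rintegral_cst m1 measurableT); apply: le_Rintegral => //.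
  - have : l2 m1 (fun x => q (x0, x)) by
      apply: (@l2_bnd _ _ _ _ _ C) => //; exact: section1_measurable.
    by case.
  - exact: integ_cst.
  - move=> x _; rewrite -real_normK ?num_real//.
    by rewrite lerXn2r// ?nnegrE// (le_trans _ (qC (x0, x))).
have mf2 : measurable_fun setT (fun p => (f p ^+ 2)%:E).
  exact/measurable_EFinP/measurable_funX.
have mf2F : measurable_fun setT (fun y => \int[m1]_x (f (x, y) ^+ 2)%:E)%E.
  apply: (measurable_fun_fubini_tonelli_G (fun p => (f p ^+ 2)%:E)) => // p.
  by rewrite lee_fin sqr_ge0.
have F0 y : (0 <= \int[m1]_x (f (x, y) ^+ 2)%:E)%E.
  by apply: integral_ge0 => x _; rewrite lee_fin sqr_ge0.
apply: (@le_lt_trans _ _ (\int[(m0 \x m2)%E]_p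
    (D%:E * \int[m1]_x (f (x, p.2) ^+ 2)%:E))%E).
  apply: ge0_le_integral => //.
  - by apply/measurable_EFinP/measurableT_comp => //; exact: measurable_funX.
  - by apply: measurable_funeM; apply: (measurableT_comp mf2F).
  - move=> p _ /=; rewrite ger0_norm ?sqr_ge0//.
    apply: (le_trans (l2_CSe (mu := m1) (f := fun x => q (p.1, x)) _ _)).
    + by apply: (@l2_bnd _ _ _ _ _ C) => //; exact: section1_measurable.
    + exact: section2_measurable.
    + by rewrite lee_wpmul2r// lee_fin.
rewrite (fubini_tonelli1 (fun p => D%:E * \int[m1]_x (f (x, p.2) ^+ 2)%:E)%E)//=.
- rewrite /fubini_F/=; under eq_integral do rewrite ge0_integralZl//.
  rewrite integral_cst//.
  have fl : (\int[m2]_y \int[m1]_x (f (x, y) ^+ 2)%:E < +oo)%E.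
    have /integrableP[_] := fi; apply: le_lt_trans.
    rewrite -(fubini_tonelli2 (fun p => (f p ^+ 2)%:E))//; last first.
      by move=> p; rewrite lee_fin sqr_ge0.
    apply: ge0_le_integral => //= [p _||p _]; rewrite ?lee_fin ?sqr_ge0// ?ler_norm//.
    by apply/measurable_EFinP/measurableT_comp => //; exact: measurable_funX.
  rewrite lte_mul_pinfty ?fin_mass//.
  + by rewrite mule_ge0// integral_ge0.
  + by rewrite ge0_fin_numE ?mule_ge0 ?integral_ge0// lte_mul_pinfty.
- by apply: measurable_funeM; apply: (measurableT_comp mf2F).
- by move=> p; rewrite mule_ge0.
Qed.

End Kernel.

(** * The matrix exponential *)

Lemma cvg_sum_fin (R : realType) (I : finType) (F : I -> nat -> R) (a : I -> R) :
  (forall i, F i @ \oo --> a i) -> (fun n => \sum_i F i n) @ \oo --> \sum_i a i.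
Proof. by move=> Fa; apply: cvg_big => //; exact: add_continuous. Qed.

Section MatrixExponential.
Context (R : realType) (m : nat).
Implicit Types (M : 'M[R]_m) (s t : R).

Definition mx_l1 M : R := \sum_i \sum_j `|M i j|.

Lemma exprmx_entry_le M k i j : `|(M ^+ k) i j| <= mx_l1 M ^+ k.
Proof.
have M0 : 0 <= mx_l1 M by apply: sumr_ge0 => ? _; apply: sumr_ge0.
elim: k i j => [|k IH] i j.
  by rewrite !expr0 mxE; case: (i == j); rewrite ?normr1 ?normr0.
rewrite exprS [M * _]/(M *m _) mxE (le_trans (ler_norm_sum _ _ _))//.
apply: (@le_trans _ _ (\sum_l `|M i l| * mx_l1 M ^+ k)).
  by apply: ler_sum => l _; rewrite normrM ler_wpM2l.
rewrite -mulr_suml exprS ler_wpM2r ?exprn_ge0//.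
rewrite /mx_l1 [leRHS](bigD1 i)//= lerDl.
by apply: sumr_ge0 => ? _; exact: sumr_ge0.
Qed.

(** Each entry of the exponential is treated as a scalar power series in t, which makes termwise
    differentiation of power series available. *)
Definition expmx_coeff M i j (k : nat) : R := (M ^+ k) i j / k`!%:R.

Lemma expmx_pseriesE M i j t :
  (fun N => \sum_(k < N) (t ^+ k / k`!%:R) * (M ^+ k) i j) =
  pseries (expmx_coeff M i j) t.
Proof.
apply/funext => N; rewrite /pseries /series /= big_mkord.
by apply: eq_bigr => k _; rewrite /expmx_coeff; ring.
Qed.

Lemma expmxE M t i j : expmx M t i j = limn (pseries (expmx_coeff M i j) t).
Proof. by rewrite mxE expmx_pseriesE. Qed.

Lemma normed_expmx_coeff_le M i j t k :
  `|expmx_coeff M i j k * t ^+ k| <= exp_coeff (mx_l1 M * `|t|) k.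
Proof.
rewrite /expmx_coeff /exp_coeff /= exprMn !normrM normrX normfV.
rewrite (ger0_norm (ler0n _ _)) mulrAC ler_wpM2r ?invr_ge0//.
by rewrite ler_wpM2r ?exprn_ge0// exprmx_entry_le.
Qed.

Lemma mx_l1_norm_ge0 M t : 0 <= mx_l1 M * `|t|.
Proof.
by rewrite mulr_ge0//; apply: sumr_ge0 => ? _; apply: sumr_ge0.
Qed.

Lemma cvg_normed_expmx M i j t :
  cvgn [normed series (fun k => expmx_coeff M i j k * t ^+ k)].
Proof.
apply: series_le_cvg (is_cvg_series_exp_coeff (mx_l1 M * `|t|)) => n /=.
- exact: normr_ge0.
- by apply: (@exp_coeff_ge0 R); exact: mx_l1_norm_ge0.
- exact: normed_expmx_coeff_le.
Qed.

Lemma is_cvg_expmx M i j t : cvgn (pseries (expmx_coeff M i j) t).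
Proof. exact/normed_cvg/cvg_normed_expmx. Qed.

Lemma cvg_expmx M i j t :
  (fun N => \sum_(k < N) (t ^+ k / k`!%:R) * (M ^+ k) i j) @ \oo -->
  expmx M t i j.
Proof. by rewrite expmxE expmx_pseriesE; exact: is_cvg_expmx. Qed.

Lemma expmx_le M i j t : `|expmx M t i j| <= expR (mx_l1 M * `|t|).
Proof.
rewrite expmxE (le_trans (lim_series_norm (@cvg_normed_expmx M i j t)))//.
apply: ler_lim; [exact: cvg_normed_expmx|exact: is_cvg_series_exp_coeff|].
near=> N; apply: ler_sum => k _; exact: normed_expmx_coeff_le.
Unshelve. all: by end_near. Qed.

Lemma measurable_expmx M i j : measurable_fun setT (fun t => expmx M t i j).
Proof.
apply: (measurable_fun_cvg
  (h := fun N t => \sum_(k < N) (t ^+ k / k`!%:R) * (M ^+ k) i j)).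
  move=> N; apply: measurable_sum => k.
  apply: measurable_funM => //; exact: measurable_funM.
by move=> t _; exact: cvg_expmx.
Qed.

Lemma expmx0 M : expmx M 0 = 1%:M.
Proof.
apply/matrixP => i j; rewrite mxE; apply/cvg_lim => //.
have h n : (0 < n)%N ->
    (1%:M : 'M[R]_m) i j = \sum_(k < n) (0 ^+ k / k`!%:R) * (M ^+ k) i j.
  case: n => // n _; rewrite big_ord_recl big1 ?addr0 => [|k _].
    by rewrite expr0 fact0 invr1 !mul1r expr0.
  by rewrite expr0n /= !mul0r.
apply: cvg_near_cst; near=> n; apply/esym/h; near: n; exact: nbhs_infty_gt.
Unshelve. all: by end_near. Qed.

(** The limit on the right is also that of [expmx_mulmxr], whence commutation, and it is the sum of
    the termwise differentiated series. *)
Lemma expmx_mulmxl M t i j : (M *m expmx M t) i j =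
  limn (fun N => \sum_(k < N) (t ^+ k / k`!%:R) * (M ^+ k.+1) i j).
Proof.
apply/esym/cvg_lim => //; rewrite mxE.
rewrite (_ : (fun N => _) = (fun N => \sum_l M i l *
    \sum_(k < N) (t ^+ k / k`!%:R) * (M ^+ k) l j)).
  by apply: cvg_sum_fin => l; apply: cvgMl_tmp; exact: cvg_expmx.
apply/funext => N; under [RHS]eq_bigr do rewrite mulr_sumr.
rewrite exchange_big; apply: eq_bigr => k _.
by rewrite exprS mxE mulr_sumr; apply: eq_bigr => l _; ring.
Qed.

Lemma expmx_mulmxr M t i j : (expmx M t *m M) i j =
  limn (fun N => \sum_(k < N) (t ^+ k / k`!%:R) * (M ^+ k.+1) i j).
Proof.
apply/esym/cvg_lim => //; rewrite mxE.
rewrite (_ : (fun N => _) = (fun N => \sum_l 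
    (\sum_(k < N) (t ^+ k / k`!%:R) * (M ^+ k) i l) * M l j)).
  by apply: cvg_sum_fin => l; apply: cvgMr_tmp; exact: cvg_expmx.
apply/funext => N; under [RHS]eq_bigr do rewrite mulr_suml.
rewrite exchange_big; apply: eq_bigr => k _.
by rewrite exprSr mxE mulr_sumr; apply: eq_bigr => l _; ring.
Qed.

Lemma expmx_comm M t : M *m expmx M t = expmx M t *m M.
Proof. by apply/matrixP => i j; rewrite expmx_mulmxl expmx_mulmxr. Qed.

Lemma pseries_diffs_expmx M i j t :
  pseries (pseries_diffs (expmx_coeff M i j)) t =
  (fun N => \sum_(k < N) (t ^+ k / k`!%:R) * (M ^+ k.+1) i j).
Proof.
apply/funext => N; rewrite /pseries /series /= big_mkord.
apply: eq_bigr => k _; rewrite /pseries_diffs /expmx_coeff.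
rewrite factS natrM; field.
by rewrite nat1r !pnatr_eq0 -lt0n fact_gt0.
Qed.

Lemma is_derive_expmx M i j t :
  is_derive t (1 : R) (fun t => expmx M t i j) ((M *m expmx M t) i j).
Proof.
under eq_fun do rewrite expmxE.
rewrite expmx_mulmxl -pseries_diffs_expmx.
(* Termwise differentiation at t asks that the series and its first two formal derivatives converge
   at a point of modulus larger than |t|; the point |t| + 1 is taken. The p-th formal derivative is
   M^p times the exponential series. *)
have cvgD p : cvgn (fun N =>
    \sum_(k < N) ((`|t| + 1) ^+ k / k`!%:R) * (M ^+ (p + k)) i j).
  rewrite (_ : (fun N => _) = (fun N => \sum_l (M ^+ p) i l *
    \sum_(k < N) ((`|t| + 1) ^+ k / k`!%:R) * (M ^+ k) l j)).
    apply/cvg_ex; exists (\sum_l (M ^+ p) i l * expmx M (`|t| + 1) l j).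
    by apply: cvg_sum_fin => l; apply: cvgMl_tmp; exact: cvg_expmx.
  apply/funext => N; under [RHS]eq_bigr do rewrite mulr_sumr.
  rewrite exchange_big; apply: eq_bigr => k _.
  by rewrite exprD mxE mulr_sumr; apply: eq_bigr => l _; ring.
apply: (@pseries_snd_diffs _ _ (`|t| + 1)).
- exact: is_cvg_expmx.
- by rewrite pseries_diffs_expmx; exact: (cvgD 1%N).
- rewrite (_ : pseries _ _ = (fun N =>
    \sum_(k < N) ((`|t| + 1) ^+ k / k`!%:R) * (M ^+ (2 + k)) i j)) //.
  apply/funext => N; rewrite /pseries /series /= big_mkord.
  apply: eq_bigr => k _; rewrite /pseries_diffs /expmx_coeff !factS !natrM add2n.
  by field; rewrite nat1r -natrD !pnatr_eq0 -lt0n fact_gt0.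
- by rewrite [ltRHS]ger0_norm ?addr_ge0// ltrDl.
Qed.

(** The product of the exponentials at x and at s + t - x has zero derivative in x; its values at x
    = s + t and x = s are the two sides. *)
Lemma expmxD M s t : expmx M (s + t) = expmx M s *m expmx M t.
Proof.
apply/matrixP => i j; rewrite [RHS]mxE.
pose h x := \sum_l expmx M x i l * expmx M (s + t - x) l j.
have hd x : is_derive x (1 : R) h 0.
  have dl l : is_derive x (1 : R)
      (fun x => expmx M x i l * expmx M (s + t - x) l j)
      (expmx M x i l * - (M *m expmx M (s + t - x)) l j +
       expmx M (s + t - x) l j * (expmx M x *m M) i l).
    rewrite -expmx_comm; apply: is_deriveM; first exact: is_derive_expmx.
    rewrite -mulrN1; apply: (@is_derive1_comp _ (fun x => expmx M x l j)).
      exact: is_derive_expmx.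
    by rewrite -[-1]add0r; apply: is_deriveB.
  rewrite (_ : h = \sum_l (fun x => expmx M x i l * expmx M (s + t - x) l j)).
    rewrite (_ : 0 = \sum_l (expmx M x i l * - (M *m expmx M (s + t - x)) l j +
       expmx M (s + t - x) l j * (expmx M x *m M) i l)).
      exact: is_derive_sum.
    rewrite big_split/=; apply/esym/eqP; rewrite addr_eq0 -sumrN; apply/eqP.
    rewrite (eq_bigr (fun l => - (expmx M x i l * (M *m expmx M (s + t - x)) l j))); last first.
      by move=> l _; rewrite mulrN.
    rewrite !sumrN; congr (- _).
    transitivity ((expmx M x *m (M *m expmx M (s + t - x))) i j); first by rewrite mxE.
    by rewrite mulmxA mxE; apply: eq_bigr => l _; rewrite mulrC.
  by apply/funext => y; rewrite /h fct_sumE.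
have := is_derive_0_is_cst (s + t) s hd; rewrite /h.
rewrite subrr expmx0 (_ : s + t - s = t); last by ring.
move=> <-.
transitivity ((expmx M (s + t) *m 1%:M) i j); first by rewrite mulmx1.
by rewrite mxE.
Qed.

End MatrixExponential.

(** * Vector-valued functions and integral kernels *)

Section ColumnVectors.
Context (R : realType).

Definition dot n (u v : 'cV[R]_n) : R := \sum_i u i 0 * v i 0.

Lemma mulmx_trE n (u v : 'cV[R]_n) : (u^T *m v) 0 0 = dot u v.
Proof. by rewrite mxE; apply: eq_bigr => i _; rewrite mxE. Qed.

Lemma dotDl n (u v w : 'cV[R]_n) : dot (u + v) w = dot u w + dot v w.
Proof. by rewrite -!mulmx_trE linearD/= mulmxDl mxE. Qed.

Lemma dotDr n (u v w : 'cV[R]_n) : dot u (v + w) = dot u v + dot u w.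
Proof. by rewrite -!mulmx_trE mulmxDr mxE. Qed.

Lemma dotZl n k (u v : 'cV[R]_n) : dot (k *: u) v = k * dot u v.
Proof. by rewrite -!mulmx_trE linearZ/= -scalemxAl mxE. Qed.

Lemma dotZr n k (u v : 'cV[R]_n) : dot u (k *: v) = k * dot u v.
Proof. by rewrite -!mulmx_trE -scalemxAr mxE. Qed.

Lemma dotBl n (u v w : 'cV[R]_n) : dot (u - v) w = dot u w - dot v w.
Proof. by rewrite -scaleN1r dotDl dotZl mulN1r. Qed.

Lemma dot0l n (v : 'cV[R]_n) : dot 0 v = 0.
Proof. by rewrite /dot big1// => i _; rewrite mxE mul0r. Qed.

Lemma dotC n (u v : 'cV[R]_n) : dot u v = dot v u.
Proof. by apply: eq_bigr => i _; rewrite mulrC. Qed.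

Lemma dot_mulmxr m n (M : 'M[R]_(m, n)) u v : dot u (M *m v) = dot (M^T *m u) v.
Proof. by rewrite -!mulmx_trE mulmxA trmx_mul trmxK. Qed.

Lemma dot_ge0 n (u : 'cV[R]_n) : 0 <= dot u u.
Proof. by apply: sumr_ge0 => i _; rewrite -expr2 sqr_ge0. Qed.

End ColumnVectors.

Section VectorL2.
Context d (X : measurableType d) (R : realType).
Variable mu : {measure set X -> \bar R}.

Definition vl2 n (v : X -> 'cV[R]_n) := forall i, l2 mu (fun x => v x i 0).

Definition bmx m n (F : X -> 'M[R]_(m, n)) := forall i j,
  measurable_fun setT (fun x => F x i j) /\ exists C, forall x, `|F x i j| <= C.

Lemma vl2D n (u v : X -> 'cV[R]_n) : vl2 u -> vl2 v -> vl2 (fun x => u x + v x).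
Proof. by move=> u2 v2 i; under eq_fun do rewrite mxE; exact: l2D. Qed.

Lemma vl2Z n k (u : X -> 'cV[R]_n) : vl2 u -> vl2 (fun x => k *: u x).
Proof. by move=> u2 i; under eq_fun do rewrite mxE; exact: l2Z. Qed.

Lemma vl2N n (u : X -> 'cV[R]_n) : vl2 u -> vl2 (fun x => - u x).
Proof. by move=> u2 i; under eq_fun do rewrite mxE; exact: l2N. Qed.

Lemma vl2B n (u v : X -> 'cV[R]_n) : vl2 u -> vl2 v -> vl2 (fun x => u x - v x).
Proof. by move=> u2 v2; apply: vl2D => //; exact: vl2N. Qed.

Lemma vl20 n : vl2 (fun=> 0 : 'cV[R]_n).
Proof. by move=> i; under eq_fun do rewrite mxE; exact: l20. Qed.

Lemma vl2_sum n I (s : seq I) (F : I -> X -> 'cV[R]_n) :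
  (forall i, vl2 (F i)) -> vl2 (fun x => \sum_(i <- s) F i x).
Proof. by move=> Fi k; under eq_fun do rewrite summxE; apply: l2_sum => i; exact: Fi. Qed.

Lemma vl2_bmx m n (F : X -> 'M[R]_(m, n)) u :
  bmx F -> vl2 u -> vl2 (fun x => F x *m u x).
Proof.
move=> bF u2 i; under eq_fun do rewrite mxE.
by apply: l2_sum => j; have [mF [C FC]] := bF i j; exact: (l2_bndM mF FC).
Qed.

Lemma bmx_cst m n (F : 'M[R]_(m, n)) : bmx (fun=> F).
Proof. by move=> i j; split; [exact: measurable_cst|exists `|F i j|]. Qed.

Lemma vl2_mx m n (F : 'M[R]_(m, n)) u : vl2 u -> vl2 (fun x => F *m u x).
Proof. by move=> u2; apply: vl2_bmx => //; exact: bmx_cst. Qed.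

Lemma bmx_tr m n (F : X -> 'M[R]_(m, n)) : bmx F -> bmx (fun x => (F x)^T).
Proof.
by move=> bF i j; have [? [C ?]] := bF j i; split;
  [under eq_fun do rewrite mxE|exists C => x; rewrite mxE].
Qed.

Lemma integ_dot n (u v : X -> 'cV[R]_n) : vl2 u -> vl2 v ->
  integ mu (fun x => dot (u x) (v x)).
Proof. by move=> u2 v2; apply: integ_sum => i; exact: l2M. Qed.

(** Removes the first-order term of the cost at a control whose gradient has zero norm. Each
    component of [v] has zero norm, so the scalar Cauchy-Schwarz inequality applies
    componentwise. *)
Lemma vl2_CS0 n (u v : X -> 'cV[R]_n) : vl2 u -> vl2 v ->
  \int[mu]_x dot (v x) (v x) = 0 -> \int[mu]_x dot (u x) (v x) = 0.
Proof.
move=> u2 v2; rewrite /dot !Rintegral_sum; try by move=> i; exact: l2M.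
move=> v0; apply: big1 => i _; apply/eqP; rewrite -sqrf_eq0 eq_le sqr_ge0 andbT.
apply: (le_trans (l2_CS (u2 i) (v2 i))).
suff -> : \int[mu]_x (v x i 0 ^+ 2) = 0 by rewrite mulr0.
move: v0 => /eqP; rewrite psumr_eq0 => [/allP/(_ i)|j _]; last first.
  by apply: Rintegral_ge0 => x _; rewrite -expr2 sqr_ge0.
rewrite mem_index_enum => /(_ isT) /= /eqP v0; rewrite -[RHS]v0.
by apply: eq_Rintegral => x _; rewrite expr2.
Qed.

End VectorL2.

Section KernelOperator.
Context d0 d (X0 : measurableType d0) (X : measurableType d) (R : realType).
Variables (m0 : {finite_measure set X0 -> \bar R})
  (mu : {finite_measure set X -> \bar R}).

(* The sum is kept outside the integrals so that the measurability of [kop K u]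
   does not depend on the integrability of [u]. *)
Definition kop m n (K : X0 -> X -> 'M[R]_(m, n)) (u : X -> 'cV[R]_n) (x0 : X0) :
    'cV[R]_m :=
  \col_i \sum_j \int[mu]_x (K x0 x i j * u x j 0).

Definition bkernel m n (K : X0 -> X -> 'M[R]_(m, n)) :=
  bmx (fun p : X0 * X => K p.1 p.2).

Lemma kernel_bmx m n (K : X0 -> X -> 'M[R]_(m, n)) x0 :
  bkernel K -> bmx (K x0).
Proof.
move=> bK i j; have [mK [C KC]] := bK i j; split.
  exact: (section1_measurable (f := fun p : X0 * X => K p.1 p.2 i j)).
by exists C => x; exact: (KC (x0, x)).
Qed.

Lemma bmx_l2 (nu : {finite_measure set X -> \bar R}) m n (F : X -> 'M[R]_(m, n))
  i j : bmx F -> l2 nu (fun x => F x i j).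
Proof. by move=> /(_ i j)[mF [C FC]]; exact: (@l2_bnd _ _ _ nu _ C). Qed.

Lemma kernel_l2 m n (K : X0 -> X -> 'M[R]_(m, n)) i j : bkernel K ->
  l2 (m0 \x mu)%E (fun p => K p.1 p.2 i j).
Proof.
move=> /(_ i j)[mK [C KC]].
have one0 : l2 m0 (fun=> 1) by apply: (@l2_bnd _ _ _ _ _ 1) => // x; rewrite normr1.
have one : l2 mu (fun=> 1) by apply: (@l2_bnd _ _ _ _ _ 1) => // x; rewrite normr1.
have := l2_bndM mK KC (l2_tensor one0 one).
by under eq_fun do rewrite mulr1 mulr1.
Qed.

Lemma kopE m n (K : X0 -> X -> 'M[R]_(m, n)) u x0 : bmx (K x0) -> vl2 mu u ->
  kop K u x0 = \col_i \int[mu]_x (K x0 x *m u x) i 0.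
Proof.
move=> bK u2; apply/matrixP => i k; rewrite !mxE.
under eq_Rintegral do rewrite mxE.
by rewrite Rintegral_sum// => j; apply: l2M => //; exact: bmx_l2.
Qed.

Lemma kopD m n (K : X0 -> X -> 'M[R]_(m, n)) u v x0 : bmx (K x0) ->
  vl2 mu u -> vl2 mu v -> kop K (fun x => u x + v x) x0 = kop K u x0 + kop K v x0.
Proof.
move=> bK u2 v2; apply/matrixP => i k; rewrite !mxE -big_split/=.
apply: eq_bigr => j _; rewrite -RintegralD//; try by apply: l2M => //; exact: bmx_l2.
by apply: eq_Rintegral => x _; rewrite mxE mulrDr.
Qed.

Lemma kopZ m n (K : X0 -> X -> 'M[R]_(m, n)) k u x0 : bmx (K x0) ->
  vl2 mu u -> kop K (fun x => k *: u x) x0 = k *: kop K u x0.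
Proof.
move=> bK u2; apply/matrixP => i ?; rewrite !mxE mulr_sumr.
apply: eq_bigr => j _; rewrite -RintegralZl//; last by apply: l2M => //; exact: bmx_l2.
by apply: eq_Rintegral => x _; rewrite mxE mulrCA.
Qed.

Lemma kop_mulmxl p m n (E : 'M[R]_(p, m)) (K : X0 -> X -> 'M[R]_(m, n)) u x0 :
  bmx (K x0) -> vl2 mu u ->
  kop (fun x0 x => E *m K x0 x) u x0 = E *m kop K u x0.
Proof.
move=> bK u2; apply/matrixP => i ?; rewrite !mxE.
under [RHS]eq_bigr do rewrite mxE mulr_sumr.
rewrite exchange_big; apply: eq_bigr => j _.
have Ku k : integ mu (fun x => K x0 x k j * u x j 0).
  by apply: l2M => //; exact: bmx_l2.
transitivity (\sum_k \int[mu]_x (E i k * (K x0 x k j * u x j 0))); last first.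
  by apply: eq_bigr => k _; rewrite RintegralZl//; exact: Ku.
rewrite -Rintegral_sum => [|k]; last by apply: integZ.
apply: eq_Rintegral => x _; rewrite mxE mulr_suml.
by apply: eq_bigr => k _; rewrite mulrA.
Qed.

Lemma kop_kerD m n (K K' : X0 -> X -> 'M[R]_(m, n)) u x0 :
  bmx (K x0) -> bmx (K' x0) -> vl2 mu u ->
  kop (fun x0 x => K x0 x + K' x0 x) u x0 = kop K u x0 + kop K' u x0.
Proof.
move=> bK bK' u2; apply/matrixP => i ?; rewrite !mxE -big_split/=.
apply: eq_bigr => j _; rewrite -RintegralD//; try by apply: l2M => //; exact: bmx_l2.
by apply: eq_Rintegral => x _; rewrite mxE mulrDl.
Qed.

Lemma bmx_mulmxl p m n (E : 'M[R]_(p, m)) (F : X -> 'M[R]_(m, n)) :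
  bmx F -> bmx (fun x => E *m F x).
Proof.
move=> bF i j; split.
  under eq_fun do rewrite mxE; apply: measurable_sum => k.
  by apply: measurable_funM => //; case: (bF k j).
have /boolp.choice[C FC] : forall k, exists C, forall x, `|F x k j| <= C.
  by move=> k; case: (bF k j).
exists (\sum_k `|E i k| * C k) => x; rewrite mxE (le_trans (ler_norm_sum _ _ _))//.
by apply: ler_sum => k _; rewrite normrM ler_wpM2l.
Qed.

Lemma dot_kop m n (K : X0 -> X -> 'M[R]_(m, n)) u x0 (v : 'cV[R]_m) :
  bmx (K x0) -> vl2 mu u ->
  dot (kop K u x0) v = \int[mu]_x dot (u x) ((K x0 x)^T *m v).
Proof.
move=> bK u2; have Ku i j : integ mu (fun x => K x0 x i j * u x j 0).
  by apply: l2M => //; exact: bmx_l2.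
transitivity (\sum_i \sum_j \int[mu]_x (v i 0 * (K x0 x i j * u x j 0))).
  apply: eq_bigr => i _; rewrite mxE mulr_suml; apply: eq_bigr => j _.
  by rewrite mulrC RintegralZl//; exact: Ku.
transitivity (\int[mu]_x \sum_i \sum_j v i 0 * (K x0 x i j * u x j 0)).
  rewrite Rintegral_sum => [|i]; last by apply: integ_sum => j; apply: integZ.
  by apply: eq_bigr => i _; rewrite Rintegral_sum// => j; apply: integZ.
apply: eq_Rintegral => x _; rewrite exchange_big; apply: eq_bigr => j _.
rewrite mxE mulr_sumr; apply: eq_bigr => i _; rewrite mxE; ring.
Qed.

Lemma kop_ae m n (K K' : X0 -> X -> 'M[R]_(m, n)) u v x0 :
  {ae mu, forall x, K x0 x = K' x0 x /\ u x = v x} -> kop K u x0 = kop K' v x0.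
Proof.
move=> ae; apply/matrixP => i ?; rewrite !mxE; apply: eq_bigr => j _.
by apply: ae_eq_Rintegral; apply: filterS ae => x [-> ->].
Qed.

Lemma kop_vl2 m n (K : X0 -> X -> 'M[R]_(m, n)) u : bkernel K -> vl2 mu u ->
  vl2 m0 (kop K u).
Proof.
move=> bK u2 i; under eq_fun do rewrite mxE.
apply: l2_sum => j; have := l2_partial1 (kernel_l2 i j bK) (u2 j).
by under eq_fun do under eq_Rintegral do rewrite mulrC.
Qed.

End KernelOperator.

Section KernelAdjoint.
Context d0 d (X0 : measurableType d0) (X : measurableType d) (R : realType).
Variables (m0 : {finite_measure set X0 -> \bar R})
  (mu : {finite_measure set X -> \bar R}).

(** Fubini, entry by entry. Applied to the Duhamel kernel, the transposed kernel produces the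
    adjoint state in the gradient of the cost. *)
Lemma kop_adjoint m n (K : X0 -> X -> 'M[R]_(m, n)) u v : bkernel K ->
  vl2 mu u -> vl2 m0 v ->
  \int[m0]_x dot (kop mu K u x) (v x) =
  \int[mu]_y dot (u y) (kop m0 (fun y x => (K x y)^T) v y).
Proof.
move=> bK u2 v2.
have bKt : bkernel (fun y x => (K x y)^T).
  move=> i k; have [mK [C KC]] := bK k i; split.
    under eq_fun do rewrite mxE.
    have mswap : measurable_fun setT (fun p : X * X0 => (p.2, p.1)).
      exact: measurable_fun_pair.
    exact: (measurableT_comp mK mswap).
  by exists C => p; rewrite mxE; exact: (KC (p.2, p.1)).
have Ktv := kop_vl2 mu bKt v2.
rewrite /dot !Rintegral_sum; last 2 first.
- by move=> j; exact: l2M.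
- by move=> i; apply: l2M => //; exact: kop_vl2.
transitivity (\sum_i \sum_j \int[m0]_x (v x i 0 * \int[mu]_y (u y j 0 * K x y i j))).
  apply: eq_bigr => i _; rewrite -Rintegral_sum; last first.
    by move=> j; apply: l2M => //; apply: (l2_partial1 (kernel_l2 m0 mu i j bK)).
  apply: eq_Rintegral => x _; rewrite mxE mulrC mulr_sumr; apply: eq_bigr => j _.
  by congr (_ * _); apply: eq_Rintegral => y _; rewrite mulrC.
rewrite exchange_big; apply: eq_bigr => j _.
transitivity (\sum_i \int[mu]_y (u y j 0 * \int[m0]_x (v x i 0 * K x y i j))).
  apply: eq_bigr => i _.
  by rewrite (l2_fubini (kernel_l2 m0 mu i j bK) (v2 i) (u2 j)).
rewrite -Rintegral_sum; last first.
  by move=> i; apply: l2M => //; apply: (l2_partial2 (kernel_l2 m0 mu i j bK)).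
apply: eq_Rintegral => y _; rewrite mxE -mulr_sumr; congr (_ * _).
by apply: eq_bigr => i _; apply: eq_Rintegral => x _; rewrite mxE mulrC.
Qed.

End KernelAdjoint.

Lemma ae_forall_fin d (X : measurableType d) (R : realType)
    (mu : {measure set X -> \bar R}) (I : finType) (P : I -> X -> Prop) :
  (forall i, {ae mu, forall x, P i x}) -> {ae mu, forall x, forall i, P i x}.
Proof.
move=> aeP; suff : forall s : seq I, {ae mu, forall x, {in s, forall i, P i x}}.
  move=> /(_ (index_enum I)); apply: filterS => x h i.
  by apply: h; rewrite mem_index_enum.
elim=> [|i s IH]; first by apply: nearW => x i; rewrite in_nil.
apply: filterS2 (aeP i) IH => x Pi Ps k.
by rewrite inE => /predU1P[->//|]; exact: Ps.
Qed.

Section JointKernel.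
Context d0 d d2 (X0 : measurableType d0) (X : measurableType d)
  (X2 : measurableType d2) (R : realType).
Variables (m0 : {finite_measure set X0 -> \bar R})
  (mu : {finite_measure set X -> \bar R})
  (m2 : {finite_measure set X2 -> \bar R}).

Definition jl2 n (u : X -> X2 -> 'cV[R]_n) :=
  vl2 (mu \x m2)%E (fun p => u p.1 p.2).

Lemma jl2_ae1 n (u : X -> X2 -> 'cV[R]_n) : jl2 u ->
  {ae mu, forall x, vl2 m2 (u x)}.
Proof. by move=> u2; apply: ae_forall_fin => i; exact: (l2_ae_section1 (u2 i)). Qed.

Lemma jl2_ae2 n (u : X -> X2 -> 'cV[R]_n) : jl2 u ->
  {ae m2, forall y, vl2 mu (fun x => u x y)}.
Proof. by move=> u2; apply: ae_forall_fin => i; exact: (l2_ae_section2 (u2 i)). Qed.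

Lemma jl2_tensor m n (F : X -> 'M[R]_(m, n)) (v : X2 -> 'cV[R]_n) :
  bmx F -> vl2 m2 v -> jl2 (fun x y => F x *m v y).
Proof.
move=> bF v2 i; under eq_fun do rewrite mxE.
by apply: l2_sum => j; exact: (l2_tensor (bmx_l2 mu i j bF) (v2 j)).
Qed.

Lemma jkop_vl2 m n (K : X0 -> X -> 'M[R]_(m, n)) u x0 : bmx (K x0) -> jl2 u ->
  vl2 m2 (fun y => kop mu K (fun x => u x y) x0).
Proof.
move=> bK u2 i; under eq_fun do rewrite mxE.
apply: l2_sum => j; exact: (l2_partial2 (u2 j) (bmx_l2 mu i j bK)).
Qed.

(** A kernel acting in one variable commutes with integration in the other. With [k] a basis
    function of S, this shows that evolution in time preserves orthogonality to S. *)
Lemma jkop_fubini m n (K : X0 -> X -> 'M[R]_(m, n)) u x0 k i :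
  bmx (K x0) -> jl2 u -> l2 m2 k ->
  \int[m2]_y (k y * kop mu K (fun x => u x y) x0 i 0) =
  kop mu K (fun x => \col_j \int[m2]_y (k y * u x y j 0)) x0 i 0.
Proof.
move=> bK u2 k2; rewrite mxE; under eq_Rintegral do rewrite mxE mulr_sumr.
rewrite Rintegral_sum; last first.
  by move=> j; apply: l2M => //; exact: (l2_partial2 (u2 j) (bmx_l2 mu i j bK)).
apply: eq_bigr => j _.
rewrite (l2_fubini (u2 j) (bmx_l2 mu i j bK) k2).
by apply: eq_Rintegral => x _; rewrite mxE.
Qed.

End JointKernel.

Section JointKernelImage.
Context d0 d d2 (X0 : measurableType d0) (X : measurableType d)
  (X2 : measurableType d2) (R : realType).
Variables (m0 : {finite_measure set X0 -> \bar R})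
  (mu : {finite_measure set X -> \bar R})
  (m2 : {finite_measure set X2 -> \bar R}).

Lemma jkop_jl2 m n (K : X0 -> X -> 'M[R]_(m, n)) u : bkernel K ->
  jl2 mu m2 u -> jl2 m0 m2 (fun x0 y => kop mu K (fun x => u x y) x0).
Proof.
move=> bK u2 i; under eq_fun do rewrite mxE.
apply: l2_sum => j; have [mK [C KC]] := bK i j.
exact: (l2_kernel m0 mK KC (u2 j)).
Qed.

End JointKernelImage.

(** * Mild solutions and quadratic costs in R^n *)

Section LebesgueOnIntervals.
Context (R : realType).
Implicit Types (a b t : R).

Lemma integral_leb a b (f : R -> \bar R) :
  (\int[leb a b]_s f s = \int[@lebesgue_measure R]_(s in `[a, b]) f s)%E.
Proof. exact: integral_mrestr. Qed.

Lemma Rintegral_leb a b (f : R -> R) :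
  \int[leb a b]_s f s = \int[@lebesgue_measure R]_(s in `[a, b]) f s.
Proof. by rewrite /Rintegral integral_leb. Qed.

(** Puts all time intervals under the single finite measure [leb 0 T], so that one family of kernels
    and one Fubini theorem serve every pair of times. *)
Lemma Rintegral_leb_sub a b T (f : R -> R) : 0 <= a -> b <= T ->
  \int[@lebesgue_measure R]_(s in `[a, b]) f s =
  \int[leb 0 T]_s (if a <= s <= b then f s else 0).
Proof.
move=> a0 bT; rewrite Rintegral_leb Rintegral_mkcond [RHS]Rintegral_mkcond.
apply: eq_Rintegral => s _; rewrite !patchE !mem_setE !in_itv /=.
case: ifPn => [/andP[as_ sb]|_]; last by case: ifP.
by rewrite (le_trans a0 as_) (le_trans sb bT).
Qed.

#[global] Instance leb_ae_filter a b : Filter (nbhs (almost_everywhere (leb a b))).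
Proof. exact: (ae_filter_ringOfSetsType (leb a b)). Qed.

Lemma leb_ae_in a b : {ae leb a b, forall s, a <= s <= b}.
Proof.
exists (~` `[a, b]%classic); split.
- by apply: measurableC; exact: measurable_itv.
- by rewrite /leb /mrestr setICl measure0.
- by move=> s /= h; rewrite in_itv /=.
Qed.

Lemma leb_ae_neq a b t : {ae leb a b, forall s, s != t}.
Proof.
exists [set t]; split => //.
- apply/eqP; rewrite eq_le measure_ge0 andbT /leb /mrestr.
  apply: (@le_trans _ _ (@lebesgue_measure R [set t])).
    by apply: le_measure; rewrite ?inE //; exact: measurableI.
  by rewrite lebesgue_measure_set1.
- by move=> s /= /negP; rewrite negbK => /eqP.
Qed.

End LebesgueOnIntervals.

Section TimeKernel.
Context (R : realType) (T : R) (n : nat).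
Hypothesis T_ge0 : 0 <= T.
Implicit Types (M N : 'M[R]_n).
Local Notation tau := (leb (0 : R) T).

(* [expmxT] and [duhamel] vanish outside the time triangle, so that they are
   bounded on the whole line and the whole plane. *)
Definition expmxT M t : 'M[R]_n := if 0 <= t <= T then expmx M t else 0.

Definition duhamel M N a t s : 'M[R]_n :=
  if [&& 0 <= s, a <= s, s <= t & t <= T] then expmx M (t - s) *m N else 0.

Lemma bmx_expmxT M : @bmx _ (measurableTypeR R) R n n (expmxT M).
Proof.
move=> i j; split.
  rewrite (_ : (fun t => _) =
      (fun t => if (0 <= t) && (t <= T) then expmx M t i j else 0)); last first.
    by apply/funext => t; rewrite /expmxT; case: ifP => // _; rewrite mxE.
  apply: measurable_fun_ifT => //; last exact: measurable_expmx.
  by apply: measurable_and; apply: measurable_fun_ler.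
exists (expR (mx_l1 M * T)) => t; rewrite /expmxT.
case: ifPn => [/andP[t0 tT]|_]; last by rewrite mxE normr0 expR_ge0.
rewrite (le_trans (expmx_le M i j t))// ler_expR ger0_norm// ler_wpM2l//.
by apply: sumr_ge0 => ? _; exact: sumr_ge0.
Qed.

Lemma kernel_duhamel M N a :
  @bkernel _ _ (measurableTypeR R) (measurableTypeR R) R n n (duhamel M N a).
Proof.
move=> i j; split.
  rewrite (_ : (fun p => _) = (fun p : measurableTypeR R * measurableTypeR R =>
      if [&& 0 <= p.2, a <= p.2, p.2 <= p.1 & p.1 <= T]
      then \sum_k expmx M (p.1 - p.2) i k * N k j else 0)); last first.
    by apply/funext => t; rewrite /duhamel; case: ifP => // _; rewrite mxE.
  apply: measurable_fun_ifT => //.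
    by do 3 (apply: measurable_and; first exact: measurable_fun_ler);
      exact: measurable_fun_ler.
  apply: measurable_sum => k; apply: measurable_funM => //.
  apply: (measurableT_comp (measurable_expmx M i k)).
  exact: measurable_funB.
exists (\sum_k expR (mx_l1 M * T) * `|N k j|) => -[t s] /=; rewrite /duhamel.
case: ifPn => [/and4P[s0 as_ st tT]|_]; last first.
  by rewrite mxE normr0 sumr_ge0// => k _; rewrite mulr_ge0// expR_ge0.
rewrite mxE (le_trans (ler_norm_sum _ _ _))//.
apply: ler_sum => k _; rewrite normrM ler_wpM2r//.
rewrite (le_trans (expmx_le M i k _))// ler_expR ger0_norm ?subr_ge0//.
rewrite ler_wpM2l//; last by rewrite (le_trans _ tT)// gerBl.
by apply: sumr_ge0 => ? _; exact: sumr_ge0.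
Qed.

Lemma duhamelE M N (u : R -> 'cV[R]_n) a t : vl2 tau u ->
  0 <= a -> a <= t -> t <= T ->
  \col_i \int[@lebesgue_measure R]_(s in `[a, t]) (expmx M (t - s) *m (N *m u s)) i 0
  = kop tau (duhamel M N a) u t.
Proof.
move=> u2 a0 at_ tT; rewrite kopE//; last exact/kernel_bmx/kernel_duhamel.
apply/matrixP => i j; rewrite !mxE (Rintegral_leb_sub _ a0 tT).
apply: eq_Rintegral => s _; rewrite /duhamel tT andbT.
case: ifPn => [/andP[as_ st]|]; first by rewrite (le_trans a0 as_) /= mulmxA.
by rewrite andbF mul0mx mxE.
Qed.

(* At s = a both terms on the right are nonzero. *)
Lemma duhamel_split M N a t : 0 <= a -> a <= t -> t <= T ->
  {ae tau, forall s, duhamel M N 0 t s =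
     expmx M (t - a) *m duhamel M N 0 a s + duhamel M N a t s}.
Proof.
move=> a0 at_ tT; apply: filterS (leb_ae_neq 0 T a) => s sa; rewrite /duhamel tT.
rewrite (le_trans at_ tT); case: (leP 0 s) => s0; rewrite /= ?mulmx0 ?addr0//.
case: (ltgtP s a) sa => //= [sa _|sa _].
  rewrite (le_trans (ltW sa) at_) /= addr0 mulmxA -expmxD.
  by congr (expmx M _ *m _); ring.
by rewrite mulmx0 add0r.
Qed.

(** The variation of constants formula started at time 0, as a function defined for all t; it
    vanishes outside [[0, T]]. *)
Definition mild M N (xi : 'cV[R]_n) (u : R -> 'cV[R]_n) (t : R) : 'cV[R]_n :=
  expmxT M t *m xi + kop tau (duhamel M N 0) u t.

Lemma mild0 M N xi u : mild M N xi u 0 = xi.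
Proof.
rewrite /mild /expmxT lexx T_ge0 expmx0 mul1mx -[RHS]addr0; congr (_ + _).
apply/matrixP => i j; rewrite !mxE big1// => k _.
(* At t = 0 the Duhamel kernel is supported on the single point s = 0. *)
rewrite (ae_eq_Rintegral (g := fun=> 0)) ?/Rintegral ?integral0//.
apply: filterS (leb_ae_neq 0 T 0) => s s0.
rewrite /duhamel; case: ifPn => [/and4P[s1 _ s2 _]|_]; last by rewrite mxE mul0r.
by move: s0; rewrite eq_le s1 s2.
Qed.

Lemma mild_semigroup M N xi u a t : vl2 tau u -> 0 <= a -> a <= t -> t <= T ->
  mild M N xi u t =
  expmx M (t - a) *m mild M N xi u a + kop tau (duhamel M N a) u t.
Proof.
move=> u2 a0 at_ tT; rewrite /mild /expmxT a0 tT (le_trans at_ tT).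
rewrite (le_trans a0 at_) /= mulmxDr mulmxA -expmxD subrK -addrA; congr (_ + _).
have bK b c : bmx (duhamel M N b c) by exact/kernel_bmx/kernel_duhamel.
(* The two Duhamel integrals are evaluated at the different times [a] and [t]. Freezing each kernel
   as a function of s alone gives them a common base point, so that they can be added. *)
have := @kop_mulmxl _ _ (measurableTypeR R) _ R tau n n n (expmx M (t - a))
  (fun=> duhamel M N 0 a) u t (bK 0 a) u2.
rewrite -[X in _ = _ *m X]/(kop tau (duhamel M N 0) u a) => <-.
have := @kop_kerD _ _ (measurableTypeR R) _ R tau n n
  (fun=> fun s => expmx M (t - a) *m duhamel M N 0 a s)
  (fun=> duhamel M N a t) u t (bmx_mulmxl _ (bK 0 a)) (bK a t) u2.
rewrite -[X in _ = _ + X]/(kop tau (duhamel M N a) u t) => <-.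
by apply: kop_ae; apply: filterS (duhamel_split M N a0 at_ tT) => s ->.
Qed.

(** The equation from time 0 already determines the state, and the semigroup law recovers the
    equation between arbitrary times. The state thus becomes a function of the control and can be
    eliminated from the minimization. *)
Lemma state_mxP M N xi u x : vl2 tau u ->
  state_mx T M N xi u x <-> (forall t, 0 <= t <= T -> x t = mild M N xi u t).
Proof.
move=> u2; split=> [[x0 xE] t /andP[t0 tT]|xE].
  rewrite (xE _ _ (lexx 0) t0 tT) duhamelE// x0 subr0 /mild /expmxT.
  by rewrite t0 tT.
split; first by rewrite xE ?mild0// lexx T_ge0.
move=> a t a0 at_ tT; rewrite duhamelE// !xE ?a0 ?tT ?(le_trans at_)//.
  exact: mild_semigroup.
by rewrite (le_trans a0).
Qed.

Lemma mild_vl2 M N xi u : vl2 tau u -> vl2 tau (mild M N xi u).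
Proof.
move=> u2; apply: vl2D; last by apply: kop_vl2 => //; exact: kernel_duhamel.
by move=> i; under eq_fun do rewrite mxE; apply: l2_sum => j;
  under eq_fun do rewrite mulrC; apply: l2Z; exact/bmx_l2/bmx_expmxT.
Qed.

Lemma mildD M N xi eta u w t : vl2 tau u -> vl2 tau w ->
  mild M N (xi + eta) (fun s => u s + w s) t = mild M N xi u t + mild M N eta w t.
Proof.
move=> u2 w2; rewrite /mild mulmxDr kopD//; first by rewrite addrACA.
exact/kernel_bmx/kernel_duhamel.
Qed.

Lemma mildZ M N xi k u t : vl2 tau u ->
  mild M N (k *: xi) (fun s => k *: u s) t = k *: mild M N xi u t.
Proof.
move=> u2; rewrite /mild kopZ// ?scalerDr ?scalemxAr//.
exact/kernel_bmx/kernel_duhamel.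
Qed.

Definition mild_cost M N Q QT xi u : R :=
  \int[tau]_t (dot (mild M N xi u t) (Q *m mild M N xi u t) + dot (u t) (u t)) +
  dot (mild M N xi u T) (QT *m mild M N xi u T).

Lemma cost_mxE M N Q QT xi u x :
  (forall t, 0 <= t <= T -> x t = mild M N xi u t) ->
  cost_mx T Q QT u x = mild_cost M N Q QT xi u.
Proof.
move=> xE; rewrite /cost_mx /mild_cost Rintegral_leb; congr (_ + _).
  apply: eq_Rintegral => t; rewrite mem_setE in_itv /= => tT.
  by rewrite -!mulmxA !mulmx_trE xE.
by rewrite -mulmxA mulmx_trE xE// T_ge0 lexx.
Qed.

(* The L^2-gradient of [mild_cost] at [u]: the sum after [2 *: u s] is N^T
   applied to the adjoint state driven by the running and the final cost. *)
Definition gradient M N Q QT xi u (s : R) : 'cV[R]_n :=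
  2 *: u s +
  (kop tau (fun s t => (duhamel M N 0 t s)^T)
     (fun t => (Q + Q^T) *m mild M N xi u t) s +
   (duhamel M N 0 T s)^T *m ((QT + QT^T) *m mild M N xi u T)).

(** The two cross terms combine into y^T (Q + Q^T) x, which is the origin of the matrices [Q + Q^T]
    and [QT + QT^T] in [gradient]. *)
Lemma dot_quadD (Q : 'M[R]_n) (x y : 'cV[R]_n) :
  dot (x + y) (Q *m (x + y)) = dot x (Q *m x) + dot y ((Q + Q^T) *m x) + dot y (Q *m y).
Proof.
rewrite mulmxDr mulmxDl !dotDl !dotDr (dot_mulmxr Q x y) (dotC _ y); ring.
Qed.

Lemma kernel_duhamel_tr M N :
  @bkernel _ _ (measurableTypeR R) (measurableTypeR R) R n n
    (fun s t => (duhamel M N 0 t s)^T).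
Proof.
move=> i j; have [mK [C KC]] := kernel_duhamel M N 0 j i; split.
  under eq_fun do rewrite mxE.
  have mswap : measurable_fun setT
      (fun p : measurableTypeR R * measurableTypeR R => (p.2, p.1)).
    exact: measurable_fun_pair.
  exact: (measurableT_comp mK mswap).
by exists C => p; rewrite mxE; exact: (KC (p.2, p.1)).
Qed.

Lemma gradient_vl2 M N Q QT xi u : vl2 tau u -> vl2 tau (gradient M N Q QT xi u).
Proof.
move=> u2; apply: vl2D; first exact: vl2Z.
apply: vl2D.
  apply: kop_vl2; first exact: kernel_duhamel_tr.
  exact/vl2_mx/mild_vl2.
apply: (vl2_bmx (mu := tau) (F := fun s => (duhamel M N 0 T s)^T)).
  exact/bmx_tr/kernel_bmx/kernel_duhamel.
by move=> i; apply: (@l2_bnd _ _ _ tau _ `|((QT + QT^T) *m mild M N xi u T) i 0|).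
Qed.

(** The state is affine in the control and the cost is quadratic, so the expansion stops at second
    order, and its last term is the cost of [w] from the initial state 0. The linear term is brought
    into the form of an inner product with [w] by moving the Duhamel operator to the other side. *)
Lemma mild_costD M N Q QT xi u w : vl2 tau u -> vl2 tau w ->
  mild_cost M N Q QT xi (fun s => u s + w s) =
  mild_cost M N Q QT xi u + \int[tau]_s dot (w s) (gradient M N Q QT xi u s) +
  mild_cost M N Q QT 0 w.
Proof.
move=> u2 w2; set x := mild M N xi u; set y := mild M N 0 w.
have xy t : mild M N xi (fun s => u s + w s) t = x t + y t.
  by rewrite -[xi in LHS]addr0 mildD.
have x2 : vl2 tau x by exact: mild_vl2.
have y2 : vl2 tau y by exact: mild_vl2.
have bK := kernel_duhamel M N 0.
have yE t : y t = kop tau (duhamel M N 0) w t by rewrite /y /mild mulmx0 add0r.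
rewrite /mild_cost /gradient -/x -/y xy.
under [X in X + _ = _]eq_Rintegral do rewrite xy.
rewrite {xy}; clearbody x; clearbody y.
have adj : \int[tau]_t dot (y t) ((Q + Q^T) *m x t) =
    \int[tau]_s dot (w s) (kop tau (fun s t => (duhamel M N 0 t s)^T)
      (fun t => (Q + Q^T) *m x t) s).
  rewrite -(kop_adjoint bK)//; last exact: vl2_mx.
  by apply: eq_Rintegral => t _; rewrite yE.
have k2 : vl2 tau (kop tau (fun s t => (duhamel M N 0 t s)^T)
      (fun t => (Q + Q^T) *m x t)).
  apply: kop_vl2; [exact: kernel_duhamel_tr|exact: vl2_mx].
have dT : dot (y T) ((QT + QT^T) *m x T) =
    \int[tau]_s dot (w s) ((duhamel M N 0 T s)^T *m ((QT + QT^T) *m x T)).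
  by rewrite yE dot_kop//; exact: kernel_bmx.
have p2 : vl2 tau (fun s => (duhamel M N 0 T s)^T *m ((QT + QT^T) *m x T)).
  apply: (vl2_bmx (mu := tau) (F := fun s => (duhamel M N 0 T s)^T)).
    exact/bmx_tr/kernel_bmx.
  by move=> i; apply: (@l2_bnd _ _ _ tau _ `|((QT + QT^T) *m x T) i 0|).
rewrite dot_quadD dT.
transitivity (\int[tau]_t (dot (x t) (Q *m x t) + dot (u t) (u t)) +
    (\int[tau]_t dot (y t) ((Q + Q^T) *m x t) + \int[tau]_t dot (w t) (2 *: u t)) +
    \int[tau]_t (dot (y t) (Q *m y t) + dot (w t) (w t)) +
    (dot (x T) (QT *m x T) + \int[tau]_s dot (w s)
      ((duhamel M N 0 T s)^T *m ((QT + QT^T) *m x T)) + dot (y T) (QT *m y T))).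
  congr (_ + _); rewrite -!RintegralD//;
    try by repeat apply: integD; apply: integ_dot => //;
    (exact: vl2_mx || exact: vl2Z).
  apply: eq_Rintegral => t _; rewrite dot_quadD.
  by rewrite dotDl !dotDr dotZr (dotC (u t) (w t)); ring.
rewrite adj.
under [X in _ = _ + X + _]eq_Rintegral do rewrite !dotDr.
rewrite !RintegralD//;
  try by repeat apply: integD; apply: integ_dot => //;
    (exact: vl2_mx || exact: vl2Z).
ring.
Qed.

End TimeKernel.

(** Measurability of [f] is asked for separately because it need not pass to a function that is
    merely equal almost everywhere. *)
Lemma l2_ae d (X : measurableType d) (R : realType)
    (mu : {measure set X -> \bar R}) (f g : X -> R) :
  measurable_fun setT f -> {ae mu, forall x, f x = g x} -> l2 mu g -> l2 mu f.
Proof.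
move=> mf fg [mg /integrableP[_ gi]]; split => //.
apply/integrableP; split; first exact/measurable_EFinP/measurable_funX.
apply: le_lt_trans gi; rewrite le_eqVlt; apply/orP; left; apply/eqP.
by apply: ae_eq_integral_gen; apply: filterS fg => x /= ->.
Qed.

(** * Decomposition along an invariant subspace *)

Section Graphon.
Context (R : realType) (c : R) (W : R -> R -> R).
Hypothesis gW : graphon c W.
Local Notation m1 := (leb (0 : R) 1).

(* [W] is only bounded and symmetric on the unit square. *)
Let W01 (p : measurableTypeR R * measurableTypeR R) : R :=
  if [&& 0 <= p.1, p.1 <= 1, 0 <= p.2 & p.2 <= 1] then W p.1 p.2 else 0.

Let mW01 : measurable_fun setT W01.
Proof.
have [mW _ _] := gW; apply: measurable_fun_ifT => //.
by do 3 (apply: measurable_and; first exact: measurable_fun_ler);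
  exact: measurable_fun_ler.
Qed.

Let W01_le p : `|W01 p| <= `|c|.
Proof.
rewrite /W01; case: ifPn => [/and4P[? ? ? ?]|_]; last by rewrite normr0.
by have [_ _ Wc] := gW; rewrite (le_trans (Wc _ _ _ _)) ?ler_norm// in_itv /=;
  apply/andP.
Qed.

Let W01_l2 : l2 (m1 \x m1)%E W01.
Proof.
have one : l2 m1 (fun=> 1) by apply: (@l2_bnd _ _ _ _ _ 1) => // x; rewrite normr1.
have := l2_bndM mW01 W01_le (l2_tensor one one).
by under eq_fun do rewrite mulr1 mulr1.
Qed.

Let gop_W01 v a : 0 <= a <= 1 -> gop W v a = \int[m1]_b (v b * W01 (a, b)).
Proof.
move=> /andP[a0 a1]; apply: ae_eq_Rintegral.
apply: filterS (leb_ae_in 0 1) => b /andP[b0 b1].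
by rewrite /W01 /= a0 a1 b0 b1 mulrC.
Qed.

(** Measurability on the whole line comes from [W], square-integrability from the truncated
    kernel. *)
Lemma gop_l2 v : l2 m1 v -> l2 m1 (gop W v).
Proof.
move=> v2; apply: l2_ae (l2_partial1 W01_l2 v2).
  have [mW _ _] := gW.
  apply: (@measurable_Rintegral1 _ _ _ _ _ m1 (fun p => W p.1 p.2 * v p.2)).
  apply: measurable_funM => //; apply: (measurableT_comp (f := v)) => //.
  by case: v2.
by apply: filterS (leb_ae_in 0 1) => a; exact: gop_W01.
Qed.

Lemma gopD v w a : l2 m1 v -> l2 m1 w -> 0 <= a <= 1 ->
  gop W (fun b => v b + w b) a = gop W v a + gop W w a.
Proof.
move=> v2 w2 a01; rewrite !gop_W01//.
have Wa : l2 m1 (fun b => W01 (a, b)).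
  by apply: (@l2_bnd _ _ _ _ _ `|c|) => //; exact: (section1_measurable (f := W01)).
rewrite -RintegralD//; try exact: l2M.
by apply: eq_Rintegral => b _; rewrite mulrDl.
Qed.

Lemma gop_sum (I : finType) (k : I -> R) (v : I -> R -> R) a :
  (forall i, l2 m1 (v i)) -> 0 <= a <= 1 ->
  gop W (fun b => \sum_i k i * v i b) a = \sum_i k i * gop W (v i) a.
Proof.
move=> v2 a01; rewrite !gop_W01//.
have Wa : l2 m1 (fun b => W01 (a, b)).
  by apply: (@l2_bnd _ _ _ _ _ `|c|) => //; exact: (section1_measurable (f := W01)).
have vW i : integ m1 (fun b => v i b * W01 (a, b)) by exact: l2M.
transitivity (\sum_i \int[m1]_b (k i * (v i b * W01 (a, b)))).
  rewrite -Rintegral_sum => [|i]; last exact: integZ.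
  apply: eq_Rintegral => b _; rewrite mulr_suml.
  by apply: eq_bigr => i _; rewrite mulrA.
by apply: eq_bigr => i _; rewrite gop_W01// RintegralZl//; exact: vW.
Qed.

Lemma gop_le v a : l2 m1 v -> 0 <= a <= 1 ->
  `|gop W v a| <= `|c| * \int[m1]_b `|v b|.
Proof.
move=> v2 a01; rewrite gop_W01//.
have Wa : l2 m1 (fun b => W01 (a, b)).
  by apply: (@l2_bnd _ _ _ _ _ `|c|) => //; exact: (section1_measurable (f := W01)).
have vi := integrable_norm (l2_integ v2).
apply: (le_trans (le_normr_Rintegral measurableT (l2M v2 Wa))).
rewrite -RintegralZl//; apply: le_Rintegral => //.
- exact: integrable_norm (l2M v2 Wa).
- exact: integZ.
- by move=> b _; rewrite normrM mulrC ler_wpM2r.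
Qed.

Lemma gop_ae v w a : {ae m1, forall b, v b = w b} -> gop W v a = gop W w a.
Proof.
by move=> vw; apply: ae_eq_Rintegral; apply: filterS vw => b ->.
Qed.

Lemma ip_gopC v w : l2 m1 v -> l2 m1 w -> ip (gop W v) w = ip (gop W w) v.
Proof.
move=> v2 w2; have ipE v' w' : ip (gop W v') w' =
    \int[m1]_a (w' a * \int[m1]_b (v' b * W01 (a, b))).
  apply: ae_eq_Rintegral; apply: filterS (leb_ae_in 0 1) => a a01.
  by rewrite gop_W01// mulrC.
rewrite !ipE -(l2_fubini W01_l2 w2 v2); apply: eq_Rintegral => b _; congr (_ * _).
apply: eq_Rintegral => a _; congr (_ * _); rewrite /W01 /=.
have [_ Ws _] := gW.
case: ifPn => [/and4P[a0 a1 b0 b1]|]; first by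
  rewrite a0 a1 b0 b1 /= Ws// in_itv/= ?a0 ?b0.
case: ifPn => // /and4P[b0 b1 a0 a1].
by rewrite a0 a1 b0 b1.
Qed.

End Graphon.

(** * Coordinates relative to an orthonormal basis of S and to its complement *)

Section Decomposition.
Context (R : realType) (S : set (R -> R)) (d : nat) (f : 'I_d -> R -> R).
Hypotheses (S_sub : L2_subspace S) (f_onb : orthonormal_basis S f).
Local Notation m1 := (leb (0 : R) 1).

Lemma L2P v : L2 v <-> l2 m1 v. Proof. exact: Lfun2P. Qed.

Lemma L2vP n (v : R -> 'cV[R]_n) : L2v v <-> vl2 m1 v.
Proof. by split=> h i; apply/L2P; exact: h. Qed.

Lemma onb_S l : S (f l). Proof. by have [[]] := f_onb. Qed.

Lemma onb_l2 l : l2 m1 (f l).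
Proof. by apply/L2P; have [+ _ _ _] := S_sub; apply; exact: onb_S. Qed.

Lemma ip_ae (v v' w : R -> R) : {ae m1, forall a, v a = v' a} -> ip v w = ip v' w.
Proof. by move=> vv; apply: ae_eq_Rintegral; apply: filterS vv => a ->. Qed.

Lemma ipC (v w : R -> R) : ip v w = ip w v.
Proof. by apply: eq_Rintegral => a _; rewrite mulrC. Qed.

Lemma ipDl v v' w : l2 m1 v -> l2 m1 v' -> l2 m1 w ->
  ip (fun a => v a + v' a) w = ip v w + ip v' w.
Proof.
move=> v2 v2' w2; rewrite /ip -RintegralD//; try exact: l2M.
by apply: eq_Rintegral => a _; rewrite mulrDl.
Qed.

Lemma ip_suml (I : finType) (k : I -> R) (v : I -> R -> R) w :
  (forall i, l2 m1 (v i)) -> l2 m1 w ->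
  ip (fun a => \sum_i k i * v i a) w = \sum_i k i * ip (v i) w.
Proof.
move=> v2 w2; have vw i : integ m1 (fun b => v i b * w b) by exact: l2M.
transitivity (\sum_i \int[m1]_b (k i * (v i b * w b))).
  rewrite -Rintegral_sum => [|i]; last exact: integZ.
  apply: eq_Rintegral => b _; rewrite mulr_suml.
  by apply: eq_bigr => i _; rewrite mulrA.
by apply: eq_bigr => i _; rewrite RintegralZl//; exact: vw.
Qed.

Lemma ip_onb k l : ip (fun a => \sum_i k i * f i a) (f l) = k l.
Proof.
rewrite ip_suml; try exact: onb_l2.
rewrite (bigD1 l)//= f_onb.2 eqxx mulr1 big1 ?addr0// => i il.
by rewrite f_onb.2 (negbTE il) mulr0.
Qed.

Lemma S_expand v : S v -> {ae m1, forall a, v a = \sum_l ip v (f l) * f l a}.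
Proof.
move=> Sv; have [[_ _ +] _] := f_onb => /(_ _ Sv)[k vk].
apply: filterS (vk) => a ->; apply: eq_bigr => l _; congr (_ * _).
by rewrite (ip_ae _ vk) ip_onb.
Qed.

Lemma S_comb (k : 'I_d -> R) : S (fun a => \sum_l k l * f l a).
Proof.
have [_ _ S0 SD] := S_sub.
suff : forall s : seq 'I_d, S (fun a => \sum_(l <- s) k l * f l a) by apply.
elim=> [|l s IH]; first by under eq_fun do rewrite big_nil.
by under eq_fun do rewrite big_cons; apply: SD => //; exact: onb_S.
Qed.

Lemma orthogonal_complementP v :
  orthogonal_complement S v <-> l2 m1 v /\ forall l, ip v (f l) = 0.
Proof.
split=> [[/L2P v2 vS]|[v2 vf]]; first by split=> // l; apply: vS; exact: onb_S.
split; first exact/L2P.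
move=> g Sg; rewrite ipC (ip_ae _ (S_expand Sg)) ip_suml//; last exact: onb_l2.
by apply: big1 => l _; rewrite (ipC (f l)) vf mulr0.
Qed.

Section Vector.
Context (n : nat).
Implicit Types (v w : R -> 'cV[R]_n) (k : 'cV[R]_(d * n)).

(** The space (S^perp)^n, tested on the basis only ([vperpP]): finitely many linear conditions,
    hence easy to hold simultaneously for almost every time. *)
Definition vperp w := vl2 m1 w /\ forall i l, ip (fun a => w a i 0) (f l) = 0.

Definition Slift k a : 'cV[R]_n :=
  \col_i \sum_l k (mxtens_index (l, i)) 0 * f l a.

(** The two components are arguments instead of [Projf f v] and [residual f v], with which they
    agree (almost everywhere for [w]). This leaves the freedom to choose [w] jointly measurable in
    time and gamma. *)
Definition split_as v k w :=
  [/\ vl2 m1 v, vperp w & {ae m1, forall a, v a = Slift k a + w a}].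

Lemma lift_vl2 k : vl2 m1 (Slift k).
Proof.
move=> i; under eq_fun do rewrite mxE.
by apply: l2_sum => l; apply: l2Z; exact: onb_l2.
Qed.

Lemma residualE v a : residual f v a = v a - Slift (Projf f v) a.
Proof.
rewrite /residual; congr (_ - _); apply/matrixP => i j; rewrite summxE mxE.
by apply: eq_bigr => l _; rewrite !mxE mxtens_indexK mulrC.
Qed.

Lemma ip_lift k i l : ip (fun a => Slift k a i 0) (f l) = k (mxtens_index (l, i)) 0.
Proof.
under eq_fun do rewrite mxE.
exact: (ip_onb (fun l => k (mxtens_index (l, i)) 0)).
Qed.

Lemma split_Projf v k w : split_as v k w -> Projf f v = k.
Proof.
move=> [v2 [w2 wf] vE]; apply/matrixP => q j; rewrite mxE ord1.
case: (mxtens_indexP q) => l i; rewrite mxtens_indexK /=.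
rewrite (@ip_ae _ (fun a => Slift k a i 0 + w a i 0)); last first.
  by apply: filterS vE => a ->; rewrite mxE.
by rewrite ipDl ?ip_lift ?wf ?addr0//; [exact: lift_vl2|exact: onb_l2].
Qed.

Lemma split_residual v k w : split_as v k w ->
  {ae m1, forall a, residual f v a = w a}.
Proof.
move=> vkw; have [_ _ vE] := vkw; apply: filterS vE => a vE.
by rewrite residualE vE (split_Projf vkw) addrC addKr.
Qed.

Lemma residual_vperp v : vl2 m1 v -> vperp (residual f v).
Proof.
move=> v2; have r2 : vl2 m1 (residual f v).
  move=> i; under eq_fun do rewrite residualE mxE [X in _ + X]mxE.
  by apply: l2B => //; exact: lift_vl2.
split=> // i l; have := ip_lift (Projf f v) i l; rewrite mxE mxtens_indexK /= => e.
have := ipDl (r2 i) (lift_vl2 (Projf f v) i) (onb_l2 l).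
rewrite e (_ : (fun a => residual f v a i 0 + Slift (Projf f v) a i 0) =
  (fun a => v a i 0)); last first.
  by apply/funext => a; rewrite residualE mxE [X in _ + X + _]mxE subrK.
by move=> h; apply: (addIr (ip (fun a => v a i 0) (f l))); rewrite add0r -h.
Qed.

Lemma split_canon v : vl2 m1 v -> split_as v (Projf f v) (residual f v).
Proof.
move=> v2; split=> //; first exact: residual_vperp.
by apply: nearW => a; rewrite residualE addrC subrK.
Qed.

Lemma vperpP w : vperp w <-> forall i, orthogonal_complement S (fun a => w a i 0).
Proof.
split=> [[w2 wf] i|h]; first by apply/orthogonal_complementP.
by split=> [i|i l]; have /orthogonal_complementP[] := h i.
Qed.

Lemma breve_partP v w : vl2 m1 v ->
  breve_part S v w <-> vl2 m1 w /\ {ae m1, forall a, w a = residual f v a}.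
Proof.
move=> v2; have [rp2 rpf] := residual_vperp v2; split.
  move=> b; have wp : vperp w by apply/vperpP => i; case: (b i).
  split; first by case: wp.
  have vS : {ae m1, forall a, forall i, v a i 0 - w a i 0 =
      \sum_l ip (fun a => v a i 0) (f l) * f l a}.
    apply: ae_forall_fin => i; have [Sv _] := b i.
    apply: filterS (S_expand Sv) => a ->; apply: eq_bigr => l _; congr (_ * _).
    have wNi : l2 m1 (fun a => - w a i 0) by apply: l2N; exact: wp.1.
    rewrite (ipDl (v2 i) wNi (onb_l2 l)).
    have -> : ip (fun a => - w a i 0) (f l) = - ip (fun a => w a i 0) (f l).
      rewrite -mulN1r -RintegralZl//; last by apply: l2M; [exact: wp.1|exact: onb_l2].
      by apply: eq_Rintegral => x _; rewrite mulN1r mulNr.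
    by rewrite wp.2 subr0.
  apply: filterS vS => a vS; apply/matrixP => i j; rewrite ord1 residualE mxE.
  rewrite [X in _ + X]mxE [X in _ - X]mxE; apply/eqP; rewrite eq_sym subr_eq addrC -subr_eq.
  apply/eqP; rewrite vS; apply: eq_bigr => l _.
  by rewrite mxE mxtens_indexK.
move=> [w2 wr] i; have [Sf Sae S0 SD] := S_sub; split.
  apply: (Sae _ _ (S_comb (fun l => ip (fun a => v a i 0) (f l)))).
    by apply/L2P; apply: l2B.
  apply: filterS wr => a ->; rewrite residualE [X in _ - X]mxE [X in _ - (_ + X)]mxE.
  rewrite opprD addrA subrr add0r opprK mxE; apply: eq_bigr => l _.
  by rewrite mxE mxtens_indexK.
apply/orthogonal_complementP; split=> // l.
by rewrite -(rpf i l); apply: ip_ae; apply: filterS wr => a ->.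
Qed.

Lemma ipvE v v' : vl2 m1 v -> vl2 m1 v' -> ipv v v' = \int[m1]_a dot (v a) (v' a).
Proof. by move=> v2 v2'; rewrite /dot Rintegral_sum// => i; exact: l2M. Qed.

Lemma ip_lift_perp k w i j : vperp w ->
  ip (fun a => w a i 0) (fun a => Slift k a j 0) = 0.
Proof.
move=> [w2 wf]; rewrite ipC; under eq_fun do rewrite mxE.
rewrite ip_suml//; last exact: onb_l2.
by apply: big1 => l _; rewrite ipC wf mulr0.
Qed.

Lemma sum_mxtens (F : 'I_(d * n) -> R) :
  \sum_q F q = \sum_l \sum_i F (mxtens_index (l, i)).
Proof.
rewrite pair_big (reindex (@mxtens_index d n)) /=.
  by apply: eq_bigr => -[].
by exists (@mxtens_unindex d n) => q _; rewrite ?mxtens_indexK ?mxtens_unindexK.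
Qed.

(** Orthonormality turns the S-part into the Euclidean product and the cross terms vanish. Both the
    costs and the weak state equation fall apart through this identity. *)
Lemma ipv_split v v' k k' w w' : split_as v k w -> split_as v' k' w' ->
  ipv v v' = dot k k' + \int[m1]_a dot (w a) (w' a).
Proof.
move=> [v2 wp vE] [v2' wp' vE'].
have [[w2 _] [w2' _]] := (wp, wp').
rewrite /dot Rintegral_sum => [|i]; last exact: l2M.
rewrite sum_mxtens exchange_big -big_split; apply: eq_bigr => i _ /=.
rewrite (@ip_ae _ (fun a => Slift k a i 0 + w a i 0)); last first.
  by apply: filterS vE => a ->; rewrite mxE.
rewrite ipC (@ip_ae _ (fun a => Slift k' a i 0 + w' a i 0)); last first.
  by apply: filterS vE' => a ->; rewrite mxE.
have lw := l2D (lift_vl2 k i) (w2 i).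
rewrite (ipDl (lift_vl2 k' i) (w2' i) lw) ipC.
rewrite (ipDl (lift_vl2 k i) (w2 i) (lift_vl2 k' i)) (ip_lift_perp k' i i wp) addr0.
rewrite (ipC (fun a => w' a i 0)) (ipDl (lift_vl2 k i) (w2 i) (w2' i)).
rewrite (ipC (fun a => Slift k a i 0) (fun a => w' a i 0)) (ip_lift_perp k i i wp').
rewrite add0r; congr (_ + _).
under eq_fun do rewrite mxE; rewrite ip_suml; last 2 first.
- by move=> l; exact: onb_l2.
- exact: lift_vl2.
by apply: eq_bigr => l _; rewrite ipC ip_lift.
Qed.

Lemma split_ae v v' k w : vl2 m1 v' -> {ae m1, forall a, v' a = v a} ->
  split_as v k w -> split_as v' k w.
Proof.
move=> v2' vv [v2 wp vE]; split=> //; apply: filterS2 vv vE => a -> //.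
Qed.

Lemma split_aer v k w w' : vl2 m1 w' -> {ae m1, forall a, w' a = w a} ->
  split_as v k w -> split_as v k w'.
Proof.
move=> w2' ww [v2 wp vE]; split=> //; last by apply: filterS2 ww vE => a ->.
split=> // i l; rewrite -(wp.2 i l); apply: ip_ae.
by apply: filterS ww => a ->.
Qed.

Lemma liftD k k' a : Slift (k + k') a = Slift k a + Slift k' a.
Proof.
apply/matrixP => i j; rewrite !mxE -big_split; apply: eq_bigr => l _ /=.
by rewrite mxE mulrDl.
Qed.

Lemma liftZ c k a : Slift (c *: k) a = c *: Slift k a.
Proof.
apply/matrixP => i j; rewrite !mxE mulr_sumr; apply: eq_bigr => l _ /=.
by rewrite mxE mulrA.
Qed.

Lemma vperpD w w' : vperp w -> vperp w' -> vperp (fun a => w a + w' a).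
Proof.
move=> [w2 wf] [w2' wf']; split=> [|i l]; first exact: vl2D.
under eq_fun do rewrite mxE; rewrite (ipDl (w2 i) (w2' i) (onb_l2 l)).
by rewrite wf wf' addr0.
Qed.

Lemma vperpM (L : 'M[R]_n) w : vperp w -> vperp (fun a => L *m w a).
Proof.
move=> [w2 wf]; split=> [|i l]; first exact: vl2_mx.
under eq_fun do rewrite mxE; rewrite ip_suml//; last exact: onb_l2.
by apply: big1 => j _; rewrite wf mulr0.
Qed.

Lemma vperpZ c w : vperp w -> vperp (fun a => c *: w a).
Proof.
move=> /(vperpM c%:M) h; rewrite (_ : (fun a => _) = (fun a => c%:M *m w a))//.
by apply/funext => a; rewrite mul_scalar_mx.
Qed.

Lemma splitD v v' k k' w w' : split_as v k w -> split_as v' k' w' ->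
  split_as (fun a => v a + v' a) (k + k') (fun a => w a + w' a).
Proof.
move=> [v2 wp vE] [v2' wp' vE']; split.
- exact: vl2D.
- exact: vperpD.
- by apply: filterS2 vE vE' => a -> ->; rewrite liftD addrACA.
Qed.

Lemma splitZ c v k w : split_as v k w ->
  split_as (fun a => c *: v a) (c *: k) (fun a => c *: w a).
Proof.
move=> [v2 wp vE]; split; [exact: vl2Z|exact: vperpZ|].
by apply: filterS vE => a ->; rewrite liftZ scalerDr.
Qed.

Section Operator.
Context (c : R) (W : R -> R -> R) (L D : 'M[R]_n).
Hypotheses (gW : graphon c W) (SW : invariant_under S W)
  (W0 : forall h, orthogonal_complement S h -> {ae m1, forall a, gop W h a = 0}).

Definition proj_op : 'M[R]_(d * n) := 1%:M *t L + gmat f W *t D.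

Lemma proj_op_mul k l i : (proj_op *m k) (mxtens_index (l, i)) 0 =
  \sum_j L i j * k (mxtens_index (l, j)) 0 +
  \sum_j D i j * \sum_h gmat f W h l * k (mxtens_index (h, j)) 0.
Proof.
rewrite mxE sum_mxtens exchange_big -big_split; apply: eq_bigr => j _ /=.
under eq_bigr do rewrite /proj_op mxE !tensmxE mulrDl.
rewrite big_split; congr (_ + _) => /=.
  rewrite (bigD1 l)//= mxE eqxx mul1r big1 ?addr0// => h hl.
  by rewrite mxE eq_sym (negbTE hl) !mul0r.
rewrite mulr_sumr; apply: eq_bigr => h _.
(* [gmat f W] stores the coordinates of the image of f_l in row l, the transpose of the usual matrix
   of an operator; the symmetry of [W] makes the two coincide. *)
have -> : gmat f W l h = gmat f W h l.
  by rewrite !mxE; apply: ip_gopC; [exact: gW|exact: onb_l2|exact: onb_l2].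
ring.
Qed.

Lemma split_vop v k w : split_as v k w ->
  split_as (vop L D W v) (proj_op *m k) (fun a => L *m w a).
Proof.
move=> [v2 wp vE].
have g2 : vl2 m1 (fun a => \col_i gop W (fun b => v b i 0) a).
  by move=> i; under eq_fun do rewrite mxE; exact: (gop_l2 gW).
split; [by apply: vl2D; exact: vl2_mx|exact: vperpM|].
have gf : {ae m1, forall a, forall l, gop W (f l) a = \sum_h gmat f W l h * f h a}.
  apply: ae_forall_fin => l; apply: filterS (S_expand (SW (onb_S l))) => a ->.
  by apply: eq_bigr => h _; rewrite mxE.
have gw : {ae m1, forall a, forall i, gop W (fun b => w b i 0) a = 0}.
  by apply: ae_forall_fin => i; apply: W0; exact: ((vperpP w).1 wp i).
have a01 := leb_ae_in (0 : R) 1.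
(* Linearity of [gop W] is available only at points of [[0, 1]], where [W] is bounded. *)
apply: filterS2 a01 (filterI vE (filterI gf gw)) => a a01 [vEa [gfa gwa]].
have gv i : gop W (fun b => v b i 0) a =
    \sum_h (\sum_l gmat f W l h * k (mxtens_index (l, i)) 0) * f h a.
  rewrite (@gop_ae _ _ _ (fun b => Slift k b i 0 + w b i 0)); last first.
    by apply: filterS vE => b ->; rewrite mxE.
  rewrite (gopD gW (lift_vl2 k i) (wp.1 i) a01) gwa addr0.
  under [fun b => Slift k b i 0]eq_fun do rewrite mxE.
  rewrite (gop_sum gW) => //; last exact: onb_l2.
  under eq_bigr do rewrite gfa mulr_sumr.
  rewrite exchange_big; apply: eq_bigr => h _; rewrite mulr_suml.
  by apply: eq_bigr => l _; ring.
rewrite /vop vEa mulmxDr addrAC; congr (_ + _).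
apply/matrixP => i j; rewrite ord1 !mxE.
under [RHS]eq_bigr do rewrite proj_op_mul mulrDl.
rewrite big_split; congr (_ + _) => /=.
  under eq_bigr do rewrite mxE mulr_sumr.
  rewrite exchange_big; apply: eq_bigr => l _; rewrite mulr_suml.
  by apply: eq_bigr => q _; ring.
under eq_bigr do rewrite mxE gv mulr_sumr.
rewrite exchange_big; apply: eq_bigr => l _; rewrite mulr_suml.
by apply: eq_bigr => q _; ring.
Qed.

Lemma split_iter v k w N : split_as v k w ->
  split_as (iter N (vop L D W) v) (proj_op ^+ N *m k) (fun a => L ^+ N *m w a).
Proof.
move=> vkw; elim: N => [|N IH] /=.
  rewrite expr0 mul1mx; under eq_fun do rewrite expr0 mul1mx.
  exact: vkw.
rewrite exprS -[proj_op * _]/(proj_op *m _) -mulmxA.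
under eq_fun do rewrite exprS -[L * _]/(L *m _) -mulmxA.
exact: split_vop.
Qed.

End Operator.

End Vector.
End Decomposition.

Lemma ae_eq0_of_ipv0 (R : realType) n (v : R -> 'cV[R]_n) :
  vl2 (leb 0 1) v -> ipv v v = 0 -> {ae leb 0 1, forall a, v a = 0}.
Proof.
move=> v2 /eqP; rewrite psumr_eq0 => [/allP v0|i _]; last first.
  by apply: Rintegral_ge0 => a _; rewrite -expr2 sqr_ge0.
have : {ae leb 0 1, forall a, forall i, v a i 0 = 0}.
  apply: ae_forall_fin => i; apply: (l2_eq0 (v2 i)).
  have := v0 i; rewrite mem_index_enum => /(_ isT)/= /eqP vi.
  by rewrite -[RHS]vi; apply: eq_Rintegral => a _; rewrite expr2.
by apply: filterS => a va; apply/matrixP => i j; rewrite ord1 va mxE.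
Qed.

(** The test function [v - w] is itself allowed as [phi]. *)
Lemma ipv_ae_eq (R : realType) n (v w : R -> 'cV[R]_n) :
  vl2 (leb 0 1) v -> vl2 (leb 0 1) w ->
  (forall phi, L2v phi -> ipv v phi = ipv w phi) ->
  {ae leb 0 1, forall a, v a = w a}.
Proof.
move=> v2 w2 vw; have vw2 := vl2B v2 w2.
have : {ae leb 0 1, forall a, v a - w a = 0}.
  apply: ae_eq0_of_ipv0 => //; rewrite ipvE//.
  under eq_Rintegral do rewrite dotBl.
  rewrite RintegralB//; try exact: integ_dot.
  by rewrite -!ipvE// vw ?subrr//; exact/L2vP.
by apply: filterS => a /eqP; rewrite subr_eq0 => /eqP.
Qed.

Lemma ae_eq_ipv (R : realType) n (v w phi : R -> 'cV[R]_n) :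
  {ae leb 0 1, forall a, v a = w a} -> ipv v phi = ipv w phi.
Proof.
move=> vw; apply: eq_bigr => i _; apply: ip_ae.
by apply: filterS vw => a ->.
Qed.

(** * The operator exponential and the state equation *)

Section ExponentialSeries.
Context (R : realType).

Definition expmx_err m (M : 'M[R]_m) t N : 'M[R]_m :=
  \sum_(k < N) (t ^+ k / k`!%:R) *: M ^+ k - expmx M t.

Lemma cvg_expmx_err m (M : 'M[R]_m) t i j :
  (fun N => expmx_err M t N i j) @ \oo --> (0 : R).
Proof.
rewrite -[X in _ --> X](subrr (expmx M t i j)).
rewrite (_ : (fun N => _) = (fun N =>
  \sum_(k < N) (t ^+ k / k`!%:R) * (M ^+ k) i j - expmx M t i j)).
  by apply: cvgB; [exact: cvg_expmx|exact: cvg_cst].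
apply/funext => N; rewrite /expmx_err mxE [X in _ + X]mxE summxE; congr (_ - _).
by apply: eq_bigr => k _; rewrite mxE.
Qed.

Lemma cvg_dot_err m (M : 'M[R]_m) t (x : 'cV[R]_m) :
  (fun N => dot (expmx_err M t N *m x) (expmx_err M t N *m x)) @ \oo --> (0 : R).
Proof.
have c i : (fun N => (expmx_err M t N *m x) i 0) @ \oo --> (0 : R).
  rewrite -[X in _ --> X](_ : \sum_j 0 * x j 0 = 0); last first.
    by rewrite big1// => j _; rewrite mul0r.
  under eq_fun do rewrite mxE.
  by apply: cvg_sum_fin => j; apply: cvgMr_tmp; exact: cvg_expmx_err.
rewrite -[X in _ --> X](_ : \sum_(j < m) 0 * 0 = 0); last first.
  by rewrite big1// => j _; rewrite mul0r.
by apply: cvg_sum_fin => i; apply: cvgM.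
Qed.

(** The error matrix does not depend on the integration variable, so the integral is a finite sum of
    products of error entries with fixed integrals; limit and integral need not be interchanged. *)
Lemma cvg_integral_dot_err d (X : measurableType d)
    (mu : {measure set X -> \bar R}) m (M : 'M[R]_m) t (w : X -> 'cV[R]_m) :
  vl2 mu w -> (fun N => \int[mu]_a dot (expmx_err M t N *m w a)
    (expmx_err M t N *m w a)) @ \oo --> (0 : R).
Proof.
move=> w2; rewrite (_ : (fun N => _) = (fun N => \sum_i \sum_j \sum_l
    (expmx_err M t N i j * expmx_err M t N i l) * \int[mu]_a (w a j 0 * w a l 0))).
  rewrite -[X in _ --> X](_ : \sum_(i < m) \sum_(j < m) \sum_(l < m)
      (0 * 0) * \int[mu]_a (w a j 0 * w a l 0) = 0); last first.
    by rewrite big1// => i _; rewrite big1// => j _; rewrite big1// => l _; rewrite !mul0r.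
  apply: cvg_sum_fin => i; apply: cvg_sum_fin => j; apply: cvg_sum_fin => l.
  by apply: cvgMr_tmp; apply: cvgM; exact: cvg_expmx_err.
apply/funext => N; set E := expmx_err M t N.
have iw i j l : integ mu (fun a => (E i j * E i l) * (w a j 0 * w a l 0)).
  by apply: integZ; exact: l2M.
transitivity (\int[mu]_a \sum_i \sum_j \sum_l (E i j * E i l) * (w a j 0 * w a l 0)).
  apply: eq_Rintegral => a _; apply: eq_bigr => i _.
  rewrite !mxE mulr_suml; apply: eq_bigr => j _; rewrite mulr_sumr.
  by apply: eq_bigr => l _; ring.
rewrite Rintegral_sum => [|i]; last by do 2 apply: integ_sum => ?.
apply: eq_bigr => i _; rewrite Rintegral_sum => [|j]; last by apply: integ_sum => ?.
apply: eq_bigr => j _; rewrite Rintegral_sum//.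
by apply: eq_bigr => l _; rewrite RintegralZl//; exact: l2M.
Qed.

End ExponentialSeries.

Section Semigroup.
Context (R : realType) (S : set (R -> R)) (d : nat) (f : 'I_d -> R -> R).
Hypotheses (S_sub : L2_subspace S) (f_onb : orthonormal_basis S f).
Context (n : nat) (c : R) (W : R -> R -> R) (L D : 'M[R]_n).
Hypotheses (gW : graphon c W) (SW : invariant_under S W)
  (W0 : forall h, orthogonal_complement S h ->
    {ae leb (0 : R) 1, forall a, gop W h a = 0}).
Local Notation m1 := (leb (0 : R) 1).
Local Notation P := (proj_op f W L D).
Local Notation split_as := (split_as f).
Local Notation opW := (vop L D W).

(** The truncation error of the operator exponential has as components the truncation errors of two
    matrix exponentials; convergence in norm is thereby reduced to finite dimension. *)
Lemma split_expmx_err t N v k w : split_as v k w ->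
  split_as (fun a => \sum_(j < N) (t ^+ j / j`!%:R) *: iter j opW v a -
      (Slift f (expmx P t *m k) a + expmx L t *m w a))
    (expmx_err P t N *m k) (fun a => expmx_err L t N *m w a).
Proof.
move=> vkw; have [v2 wp vE] := vkw.
have sp : split_as (fun a => \sum_(j < N) (t ^+ j / j`!%:R) *: iter j opW v a)
    ((\sum_(j < N) (t ^+ j / j`!%:R) *: P ^+ j) *m k)
    (fun a => (\sum_(j < N) (t ^+ j / j`!%:R) *: L ^+ j) *m w a).
  elim: N => [|N IH].
    under eq_fun do rewrite big_ord0.
    rewrite big_ord0 mul0mx; under [fun a => _ *m w a]eq_fun do rewrite big_ord0 mul0mx.
    have := splitZ S_sub f_onb 0 vkw; rewrite scale0r.
    by under eq_fun do rewrite scale0r; under [fun a => 0 *: w a]eq_fun do rewrite scale0r.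
  under eq_fun do rewrite big_ord_recr.
  rewrite big_ord_recr mulmxDl.
  under [fun a => _ *m w a]eq_fun do rewrite big_ord_recr mulmxDl.
  apply: (splitD S_sub f_onb IH); rewrite -scalemxAl.
  under [fun a => _ *m w a]eq_fun do rewrite -scalemxAl.
  apply: (splitZ S_sub f_onb); exact: (split_iter S_sub f_onb L D gW SW W0 N vkw).
have lE : split_as (fun a => Slift f (expmx P t *m k) a + expmx L t *m w a)
    (expmx P t *m k) (fun a => expmx L t *m w a).
  have wpE := vperpM S_sub f_onb (expmx L t) wp.
  split=> //; last exact: nearW.
  by apply: vl2D; [exact: (lift_vl2 S_sub f_onb)|case: wpE].
have := splitD S_sub f_onb sp (splitZ S_sub f_onb (-1) lE).
rewrite scaleN1r -mulmxBl.
under eq_fun do rewrite scaleN1r.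
by under [fun a => _ *m w a + _]eq_fun do rewrite scaleN1r -mulmxBl.
Qed.

Lemma cvg_sqrt0 (x : R^nat) : x @ \oo --> (0 : R) ->
  (fun N => Num.sqrt (x N)) @ \oo --> (0 : R).
Proof.
move=> x0; rewrite -[X in _ --> X](@sqrtr0 R).
by apply: continuous_cvg => //; exact: sqrt_continuous.
Qed.

Lemma is_expop_explicit t v k w : split_as v k w ->
  is_expop opW t v (fun a => Slift f (expmx P t *m k) a + expmx L t *m w a).
Proof.
move=> vkw; have [v2 wp vE] := vkw; split.
  apply/L2vP; apply: vl2D; first exact: (lift_vl2 S_sub f_onb).
  by have [] := vperpM S_sub f_onb (expmx L t) wp.
apply: cvg_sqrt0 => /=.
rewrite (_ : (fun N => _) = (fun N =>
    dot (expmx_err P t N *m k) (expmx_err P t N *m k) +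
    \int[m1]_a dot (expmx_err L t N *m w a) (expmx_err L t N *m w a))).
  rewrite -[X in _ --> X]addr0; apply: cvgD; first exact: cvg_dot_err.
  by apply: cvg_integral_dot_err; case: wp.
apply/funext => N; have sr := split_expmx_err t N vkw.
exact: (ipv_split S_sub f_onb sr sr).
Qed.

Lemma is_expop_unique t v w w' : vl2 m1 v -> is_expop opW t v w -> is_expop opW t v w' ->
  {ae m1, forall a, w a = w' a}.
Proof.
move=> v2 [/L2vP w2 rw] [/L2vP w2' rw'].
pose s N a := \sum_(k < N) (t ^+ k / k`!%:R) *: iter k opW v a.
have s2 N : vl2 m1 (s N).
  apply: vl2_sum => k; apply: vl2Z.
  by have [] := split_iter S_sub f_onb L D gW SW W0 k (split_canon S_sub f_onb v2).
have r0 z : vl2 m1 z ->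
    (fun N => Num.sqrt (ipv (fun a => s N a - z a) (fun a => s N a - z a))) @ \oo
      --> (0 : R) ->
    (fun N => ipv (fun a => s N a - z a) (fun a => s N a - z a)) @ \oo --> (0 : R).
  move=> z2 h; rewrite -[X in _ --> X](mulr0 (0 : R)).
  rewrite (_ : (fun N => _) = (fun N =>
    Num.sqrt (ipv (fun a => s N a - z a) (fun a => s N a - z a)) *
    Num.sqrt (ipv (fun a => s N a - z a) (fun a => s N a - z a)))).
    exact: cvgM.
  apply/funext => N; rewrite -expr2 sqr_sqrtr// ipvE//; try exact: vl2B.
  by apply: Rintegral_ge0 => a _; exact: dot_ge0.
have {}rw := r0 _ w2 rw; have {}rw' := r0 _ w2' rw'.
have ww2 := vl2B w2 w2'.
have ipv0 : ipv (fun a => w a - w' a) (fun a => w a - w' a) = 0.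
  apply/eqP; rewrite eq_le; apply/andP; split; last first.
    by rewrite ipvE//; apply: Rintegral_ge0 => a _; exact: dot_ge0.
  (* For every N, |w - w'|^2 <= 2 |s_N - w|^2 + 2 |s_N - w'|^2, by the parallelogram law. *)
  have lim0 : (fun N => 2 * ipv (fun a => s N a - w a) (fun a => s N a - w a) +
      2 * ipv (fun a => s N a - w' a) (fun a => s N a - w' a)) @ \oo --> (0 : R).
    rewrite -[X in _ --> X](_ : 2 * 0 + 2 * 0 = 0); last by rewrite mulr0 addr0.
    by apply: cvgD; apply: cvgMl_tmp.
  apply: (cvgr_to_ge lim0); apply: nearW => N.
  have sw2 := vl2B (s2 N) w2; have sw2' := vl2B (s2 N) w2'.
  rewrite !ipvE// -!RintegralZl//; try exact: integ_dot.
  rewrite -RintegralD//; try by apply: integZ; exact: integ_dot.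
  apply: le_Rintegral => //; [exact: integ_dot|by apply: integD; apply: integZ; exact: integ_dot|].
  move=> a _; have -> : w a - w' a = (s N a - w' a) - (s N a - w a).
    by rewrite opprB [RHS]addrC addrA subrK.
  move: (s N a - w' a) (s N a - w a) => p q.
  have := dot_ge0 (p + q).
  have -> : dot (p - q) (p - q) = dot p p - 2 * dot p q + dot q q.
    by rewrite dotBl !(dotC _ (p - q)) !dotBl (dotC q p); ring.
  by rewrite !dotDl !dotDr (dotC q p); lra.
apply: filterS (ae_eq0_of_ipv0 ww2 ipv0) => a /eqP.
by rewrite subr_eq0 => /eqP.
Qed.

Lemma split_expop t v k w : split_as v k w ->
  split_as (expop opW t v) (expmx P t *m k) (fun a => expmx L t *m w a).
Proof.
move=> vkw; have ex := is_expop_explicit t vkw.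
(* The explicit candidate shows that the set is inhabited, so [xget] does not return its default. *)
have ex' : is_expop opW t v (expop opW t v).
  by rewrite /expop; apply: (@xgetPex _ _ [set w | is_expop opW t v w]); eexists; exact: ex.
have [v2 wp vE] := vkw.
have wpE := vperpM S_sub f_onb (expmx L t) wp.
split=> //; first by apply/L2vP; case: ex'.
exact: is_expop_unique ex' ex.
Qed.

End Semigroup.

Lemma jl2_snd d1 d2 (X1 : measurableType d1) (X2 : measurableType d2)
    (R : realType) (mu : {finite_measure set X1 -> \bar R})
    (m2 : {finite_measure set X2 -> \bar R}) n (v : X2 -> 'cV[R]_n) :
  vl2 m2 v -> jl2 mu m2 (fun=> v).
Proof.
move=> v2; have := jl2_tensor mu (@bmx_cst _ X1 R n n 1%:M) v2.
by rewrite /jl2; under eq_fun do rewrite mul1mx.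
Qed.

(** * The state equation in split coordinates *)

Section StateEquation.
Context (R : realType) (T : R) (S : set (R -> R)) (d : nat) (f : 'I_d -> R -> R).
Hypotheses (T_ge0 : 0 <= T) (S_sub : L2_subspace S) (f_onb : orthonormal_basis S f).
Context (n : nat) (c : R) (A B : R -> R -> R) (La Da Lb Db : 'M[R]_n).
Hypotheses (gA : graphon c A) (gB : graphon c B)
  (SA : invariant_under S A) (SB : invariant_under S B)
  (A0 : forall h, orthogonal_complement S h ->
    {ae leb (0 : R) 1, forall a, gop A h a = 0})
  (B0 : forall h, orthogonal_complement S h ->
    {ae leb (0 : R) 1, forall a, gop B h a = 0}).
Local Notation m1 := (leb (0 : R) 1).
Local Notation tau := (leb (0 : R) T).
Local Notation Mp := (proj_op f A La Da).
Local Notation Np := (proj_op f B Lb Db).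
Local Notation split_as := (split_as f).
Local Notation opA := (vop La Da A).
Local Notation opB := (vop Lb Db B).

Lemma L2tvP (u : R -> R -> 'cV[R]_n) : L2tv T u <-> jl2 tau m1 u.
Proof. by split=> h i; apply/Lfun2P; exact: h. Qed.

Lemma L2tP m (u : R -> 'cV[R]_m) : L2t T u <-> vl2 tau u.
Proof. by split=> h i; apply/Lfun2P; exact: h. Qed.

Lemma Projf_vl2 (u : R -> R -> 'cV[R]_n) : jl2 tau m1 u ->
  vl2 tau (fun t => Projf f (u t)).
Proof.
move=> u2 k; under eq_fun do rewrite mxE /ip.
have := l2_partial1 (u2 (mxtens_unindex k).2) (onb_l2 S_sub f_onb (mxtens_unindex k).1).
by under eq_fun do under eq_Rintegral do rewrite mulrC.
Qed.

Lemma jkop_vperp m (K : R -> R -> 'M[R]_(m, n)) (ub : R -> R -> 'cV[R]_n) t :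
  @bmx _ (measurableTypeR R) R m n (K t) -> jl2 tau m1 ub ->
  {ae tau, forall s, vperp f (ub s)} ->
  vperp f (fun g => kop tau K (fun s => ub s g) t).
Proof.
move=> bK ub2 ubp; split=> [|i l]; first exact: jkop_vl2.
rewrite ipC /ip (jkop_fubini (mu := tau) (X0 := measurableTypeR R) i bK ub2 (onb_l2 S_sub f_onb l)).
rewrite mxE big1// => j _.
rewrite (ae_eq_Rintegral (g := fun=> 0)) ?/Rintegral ?integral0//.
apply: filterS ubp => s [_ us]; rewrite mxE.
have e : \int[m1]_y (f l y * ub s y j 0) = 0 := etrans (ipC _ _) (us j l).
by rewrite -/(Rintegral m1 setT _) e mulr0.
Qed.

Variables (u ub : R -> R -> 'cV[R]_n).
Hypotheses (u2 : jl2 tau m1 u) (ub2 : jl2 tau m1 ub)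
  (ub_breve : {ae tau, forall t, breve_part S (u t) (ub t)}).
Local Notation up := (fun t => Projf f (u t)).

Lemma ae_split_control : {ae tau, forall t, split_as (u t) (up t) (ub t)}.
Proof.
apply: filterS2 (jl2_ae1 u2) ub_breve => t ut2 /(breve_partP S_sub f_onb _ ut2)[w2 wr].
apply: (split_aer w2 wr); exact: (split_canon S_sub f_onb ut2).
Qed.

Lemma ae_ub_vperp : {ae tau, forall t, vperp f (ub t)}.
Proof. by apply: filterS ae_split_control => t []. Qed.

(** Turns the time integral of inner products, the only one that the weak equation offers, into the
    inner product with a time integral taken at each gamma. *)
Lemma integral_dot_kop (K : R -> R -> 'M[R]_n) (phi : R -> 'cV[R]_n) t :
  @bmx _ (measurableTypeR R) R n n (K t) -> vl2 m1 phi ->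
  \int[tau]_s \int[m1]_g dot (K t s *m ub s g) (phi g) =
  \int[m1]_g dot (kop tau K (fun s => ub s g) t) (phi g).
Proof.
move=> bK phi2.
have K2 : vl2 (tau \x m1)%E (fun p => K t p.1 *m ub p.1 p.2).
  apply: (vl2_bmx (mu := (tau \x m1)%E) (F := fun p => K t p.1)) => // i j.
  have [mK [C KC]] := bK i j; split; first exact: (measurableT_comp mK).
  by exists C => p; exact: KC.
have phi2' := jl2_snd tau phi2.
have h := integ_dot K2 phi2'.
rewrite (Rfubini h) /=; apply: ae_eq_Rintegral.
apply: filterS (jl2_ae2 ub2) => g ug.
rewrite (dot_kop (mu := tau) _ bK ug); apply: eq_Rintegral => s _.
by rewrite dotC dot_mulmxr dotC.
Qed.

(** An explicit pointwise representative of the right-hand side of the mild equation started from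
    [v] at time [a]; [mild_weak] justifies it. *)
Definition mild_from a (v : R -> 'cV[R]_n) t g : 'cV[R]_n :=
  Slift f (expmx Mp (t - a) *m Projf f v + kop tau (duhamel T Mp Np a) up t) g +
  (expmx La (t - a) *m residual f v g +
   kop tau (duhamel T La Lb a) (fun s => ub s g) t).

Lemma split_mild_from a v t : vl2 m1 v ->
  split_as (mild_from a v t)
    (expmx Mp (t - a) *m Projf f v + kop tau (duhamel T Mp Np a) up t)
    (fun g => expmx La (t - a) *m residual f v g +
      kop tau (duhamel T La Lb a) (fun s => ub s g) t).
Proof.
move=> v2; have bK : bmx (duhamel T La Lb a t) by exact/kernel_bmx/kernel_duhamel.
have wp : vperp f (fun g => expmx La (t - a) *m residual f v g +
      kop tau (duhamel T La Lb a) (fun s => ub s g) t).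
  apply: (vperpD S_sub f_onb).
    by apply: (vperpM S_sub f_onb); exact: (residual_vperp S_sub f_onb v2).
  by apply: jkop_vperp => //; exact: ae_ub_vperp.
split=> //; last exact: nearW.
by apply: vl2D; [exact: (lift_vl2 S_sub f_onb)|case: wp].
Qed.

Lemma mild_weak a v t phi : vl2 m1 v -> 0 <= a -> a <= t -> t <= T -> L2v phi ->
  ipv (expop opA (t - a) v) phi +
    \int[@lebesgue_measure R]_(s in `[a, t]) ipv (expop opA (t - s) (opB (u s))) phi =
  ipv (mild_from a v t) phi.
Proof.
move=> v2 a0 at_ tT /L2vP phi2; have sphi := split_canon S_sub f_onb phi2.
have sA k := split_expop S_sub f_onb La Da gA SA A0 k.
have bK : bmx (duhamel T La Lb a t) by exact/kernel_bmx/kernel_duhamel.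
have bKp : bmx (duhamel T Mp Np a t) by exact/kernel_bmx/kernel_duhamel.
have [_ [rp2 _] _] := sphi.
have E1 := ipv_split S_sub f_onb
  (sA (t - a) _ _ _ (split_canon S_sub f_onb v2)) sphi.
have E2 := ipv_split S_sub f_onb (split_mild_from a t v2) sphi.
apply: etrans (etrans (congr1 (+%R^~ _) E1) _) (esym E2) => {E1 E2}.
rewrite (Rintegral_leb_sub _ a0 tT).
(* For almost every s the integrand, which involves unspecified representatives, equals an explicit
   integrand that is measurable in s. *)
rewrite (ae_eq_Rintegral (mu := tau) (g := fun s =>
    dot (duhamel T Mp Np a t s *m up s) (Projf f phi) +
    \int[m1]_g dot (duhamel T La Lb a t s *m ub s g) (residual f phi g))); last first.
  apply: filterS2 (leb_ae_in 0 T) ae_split_control => s /andP[s0 sT] us.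
  rewrite /duhamel s0 tT andbT /=; case: ifPn => _; last first.
    rewrite mul0mx dot0l add0r (eq_Rintegral m1 (g := fun=> 0)).
      by rewrite /Rintegral integral0.
    by move=> g _; rewrite mul0mx dot0l.
  have uB := split_vop S_sub f_onb Lb Db gB SB B0 us.
  rewrite (ipv_split S_sub f_onb (sA (t - s) _ _ _ uB) sphi) mulmxA; congr (_ + _).
  by apply: eq_Rintegral => g _; rewrite mulmxA.
have Ku2 : jl2 tau m1 (fun s g => duhamel T La Lb a t s *m ub s g).
  apply: (vl2_bmx (mu := (tau \x m1)%E) (F := fun p => duhamel T La Lb a t p.1)) => // i j.
  have [mK [C KC]] := bK i j; split; first exact: (measurableT_comp mK).
  by exists C => p; exact: KC.
have Kp2 : vl2 tau (fun s => duhamel T Mp Np a t s *m up s).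
  by apply: (vl2_bmx (mu := tau)) => //; exact: Projf_vl2.
have cst2 : vl2 tau (fun=> Projf f phi).
  by move=> i; apply: (@l2_bnd _ _ _ tau _ `|Projf f phi i 0|).
have Kphi : integ tau (fun s =>
    \int[m1]_g dot (duhamel T La Lb a t s *m ub s g) (residual f phi g)).
  apply: (@integ_fubini1 _ _ _ _ R tau m1 (fun p =>
    dot (duhamel T La Lb a t p.1 *m ub p.1 p.2) (residual f phi p.2))).
  apply: integ_dot => //; exact: jl2_snd.
rewrite RintegralD//; last exact: integ_dot.
rewrite (integral_dot_kop bK rp2).
have -> : \int[tau]_s dot (duhamel T Mp Np a t s *m up s) (Projf f phi) =
    dot (kop tau (duhamel T Mp Np a) up t) (Projf f phi).
  rewrite dot_kop//; last exact: Projf_vl2.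
  by apply: eq_Rintegral => s _; rewrite dotC dot_mulmxr dotC.
rewrite dotDl addrACA; congr (_ + _).
under [RHS]eq_Rintegral do rewrite dotDl.
rewrite RintegralD//; apply: integ_dot => //.
  by apply: vl2_mx; case: (residual_vperp S_sub f_onb v2).
exact: jkop_vl2.
Qed.

Lemma split_state_unique (v y w : R -> 'cV[R]_n) k : split_as y k w -> vl2 m1 v ->
  (forall phi, L2v phi -> ipv v phi = ipv y phi) -> split_as v k w.
Proof.
move=> syk v2 vy; have [y2 _ _] := syk.
apply: split_ae syk => //; exact: ipv_ae_eq.
Qed.

Lemma kernel_duhamel_row M N a t :
  @bmx _ (measurableTypeR R) R n n (duhamel T M N a t).
Proof. exact/kernel_bmx/kernel_duhamel. Qed.

(** The weak equation from a = 0 identifies each [x t] with the explicit solution, outside a null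
    set of gamma that may depend on t. Conversely, the semigroup law in both coordinates yields the
    equation between arbitrary times. *)
Lemma state_opP x0 x : vl2 m1 x0 ->
  state_op T opA opB x0 u x <-> forall t, 0 <= t <= T ->
    split_as (x t) (mild T Mp Np (Projf f x0) up t)
      (fun g => mild T La Lb (residual f x0 g) (fun s => ub s g) t).
Proof.
move=> x02; have up2 := Projf_vl2 u2; split=> [[x2 x0E xE] t /andP[t0 tT]|xs].
  have x02' : vl2 m1 (x 0) by apply/L2vP/x2; rewrite lexx.
  have xt2 : vl2 m1 (x t) by apply/L2vP/x2; rewrite t0.
  have x0s : split_as (x 0) (Projf f x0) (residual f x0).
    by apply: split_ae (split_canon S_sub f_onb x02).
  have sm := split_mild_from 0 t x02'.
  have := split_state_unique sm xt2 _.
  rewrite (split_Projf S_sub f_onb x0s) subr0 /mild /expmxT t0 tT => h.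
  apply: split_aer (h _).
  - apply: vl2D.
      by apply: vl2_mx; case: (residual_vperp S_sub f_onb x02).
    by apply: jkop_vl2 => //; exact: kernel_duhamel_row.
  - by apply: filterS (split_residual S_sub f_onb x0s) => g ->.
  - by move=> phi phi2; rewrite (xE 0 t)// mild_weak// subr0.
have x2 t : 0 <= t <= T -> vl2 m1 (x t) by move=> /xs[].
split.
- by move=> t /x2 /L2vP.
- have [|_ _] := xs 0; first by rewrite lexx.
  rewrite mild0//; apply: filterS => g ->; rewrite mild0//.
  by rewrite residualE addrC subrK.
move=> a t a0 at_ tT phi phi2.
have tT' : 0 <= t <= T by rewrite tT (le_trans a0).
have aT' : 0 <= a <= T by rewrite a0 (le_trans at_).
rewrite mild_weak//; last exact: x2.
apply: ae_eq_ipv; have [_ _] := xs _ tT'; have xa := xs _ aT'.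
have rx := split_residual S_sub f_onb xa.
apply: filterS2 (filterI rx (jl2_ae2 ub2)) => g [rg ug] ->.
rewrite /mild_from (split_Projf S_sub f_onb xa) rg.
by rewrite -!mild_semigroup//.
Qed.

End StateEquation.

(** * Decoupling of the minimizations *)

Section RealIntegralComparison.
Context d (X : measurableType d) (R : realType) (mu : {measure set X -> \bar R}).

Lemma ae_le_Rintegral (f g : X -> R) : integ mu f -> integ mu g ->
  {ae mu, forall x, f x <= g x} -> \int[mu]_x f x <= \int[mu]_x g x.
Proof.
move=> fi gi fg; rewrite -subr_ge0 -RintegralB//.
rewrite (ae_eq_Rintegral (g := fun x => `|g x - f x|)).
  by apply: Rintegral_ge0 => x _.
by apply: filterS fg => x fg; rewrite ger0_norm// subr_ge0.
Qed.

Lemma Rintegral_eq0_ae (f : X -> R) : integ mu f -> (forall x, 0 <= f x) ->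
  \int[mu]_x f x = 0 -> {ae mu, forall x, f x = 0}.
Proof.
move=> fi f0 If0; have mf := @measurable_int _ _ _ mu setT (EFin \o f) fi.
have : (\int[mu]_x `|(f x)%:E| = 0)%E.
  rewrite (eq_integral (fun x => (f x)%:E)); last first.
    by move=> x _ /=; rewrite ger0_norm.
  rewrite -(@fineK _ (integral _ _ _)); first by congr EFin.
  by apply: integrable_fin_num => //; exact: fi.
move=> /(ae_eq_integral_abs mu measurableT mf); apply: filterS => x /(_ I).
by case.
Qed.

End RealIntegralComparison.

Section ConstantNonnegative.
Context (R : realType) (n : nat) (c : R) (W : R -> R -> R) (L D : 'M[R]_n).
Hypotheses (gW : graphon c W) (nnegW : non_negative (vop L D W)).
Local Notation m1 := (leb (0 : R) 1).

(* On functions concentrated on [0, r] the integral operator contributes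
   O(r^2), which is negligible against the O(r) of the multiplication by L. *)
Lemma non_negative_const (e : 'cV[R]_n) : 0 <= dot e (L *m e).
Proof.
set al := dot e (L *m e); set be := dot e (D *m e).
suff key r : 0 < r -> r <= 1 -> 0 <= al + r * (`|c| * `|be|).
  rewrite leNgt; apply/negP => al0.
  (* With this r the correction is at most -al / 2, so the total stays at or below al / 2 < 0. The
     summand 1 keeps the denominator positive. *)
  pose r := Num.min 1 (- al / (2 * (1 + `|c| * `|be|))).
  have K0 : 0 < 1 + `|c| * `|be| by rewrite ltr_pwDl// mulr_ge0.
  have r0 : 0 < r.
    by rewrite lt_min ltr01 /= divr_gt0 ?oppr_gt0// mulr_gt0.
  have := key r r0; rewrite ge_min lexx => /(_ isT).
  have rle : r * (2 * (1 + `|c| * `|be|)) <= - al.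
    rewrite -ler_pdivlMr; last by rewrite mulr_gt0.
    by rewrite ge_min lexx orbT.
  have := mulr_ge0 (normr_ge0 c) (normr_ge0 be); nra.
move=> r0 r1; pose phi (a : R) : R := if 0 <= a <= r then 1 else 0.
have mphi : measurable_fun setT phi.
  apply: measurable_fun_ifT => //.
  by apply: measurable_and; exact: measurable_fun_ler.
have phi0 a : 0 <= phi a by rewrite /phi; case: ifP.
have phi1 a : `|phi a| <= 1 by rewrite /phi; case: ifP; rewrite ?normr1 ?normr0.
have phi2 : l2 m1 phi by exact: (@l2_bnd _ _ _ m1 _ 1).
have Iphi : \int[m1]_a phi a = r.
  rewrite -(Rintegral_leb_sub (fun=> 1) (lexx 0) r1) Rintegral_cst//.
  by rewrite mul1r /= lebesgue_measure_itv /= lte_fin r0 oppr0 addr0.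
have phiphi : \int[m1]_a (phi a * phi a) = r.
  rewrite -Iphi; apply: eq_Rintegral => a _; rewrite /phi.
  by case: ifP; rewrite ?mulr1 ?mulr0.
pose k := \int[m1]_a (phi a * gop W phi a).
have gphi2 := gop_l2 gW phi2.
have ipvE' : ipv (fun a => phi a *: e) (vop L D W (fun a => phi a *: e)) =
    r * al + k * be.
  have v2 : vl2 m1 (fun a => phi a *: e).
    by move=> i; under eq_fun do rewrite mxE mulrC; exact: l2Z.
  have vopE a : 0 <= a <= 1 -> vop L D W (fun b => phi b *: e) a =
      phi a *: (L *m e) + gop W phi a *: (D *m e).
    move=> a01; rewrite /vop -scalemxAr; congr (_ + _).
    rewrite scalemxAr; congr (D *m _); apply/matrixP => i j; rewrite ord1 !mxE.
    have := @gop_sum _ _ _ gW 'I_1 (fun=> e i 0) (fun=> phi) a (fun=> phi2) a01.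
    rewrite big_ord1 mulrC => <-; congr (gop W _ a); apply/funext => b.
    by rewrite big_ord1 mxE mulrC.
  rewrite ipvE//; last first.
    apply: vl2D; [exact: vl2_mx|apply: vl2_mx => i].
    by under eq_fun do rewrite mxE; exact: (gop_l2 gW).
  rewrite (ae_eq_Rintegral (mu := m1) (g := fun a =>
    al * (phi a * phi a) + be * (phi a * gop W phi a))); last first.
    apply: filterS (leb_ae_in 0 1) => a a01.
    by rewrite vopE// dotDr !dotZl !dotZr /al /be; ring.
  rewrite RintegralD//; try by apply: integZ; exact: l2M.
  rewrite !RintegralZl//; try exact: l2M.
  by rewrite phiphi -/k; ring.
have kle : `|k| <= `|c| * r * r.
  apply: (le_trans (le_normr_Rintegral measurableT (l2M phi2 gphi2))).
  rewrite -[in leRHS]Iphi -RintegralZl//; last exact: l2_integ.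
  apply: ae_le_Rintegral.
  - exact: integrable_norm (l2M phi2 gphi2).
  - by apply: integZ; exact: l2_integ.
  apply: filterS (leb_ae_in 0 1) => a a01.
  rewrite normrM (ger0_norm (phi0 a)) mulrC ler_wpM2r//.
  rewrite (le_trans (gop_le gW phi2 a01))// ler_wpM2l//.
  rewrite le_eqVlt; apply/orP; left; apply/eqP.
  by apply: eq_Rintegral => b _; rewrite ger0_norm.
have := nnegW (v := fun a => phi a *: e).
rewrite ipvE' => /(_ _) h.
have {}h : 0 <= r * al + k * be.
  by apply: h; apply/L2vP => i; under eq_fun do rewrite mxE mulrC; exact: l2Z.
have kb : k * be <= `|c| * r * r * `|be|.
  by rewrite (le_trans (ler_norm _))// normrM ler_wpM2r.
rewrite -(pmulr_rge0 _ r0); nra.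
Qed.

End ConstantNonnegative.

(** * The cost as a function of the control alone, and families of controls indexed by gamma *)

Section CostFunctional.
Context (R : realType) (T : R) (n : nat).
Hypothesis T_ge0 : 0 <= T.
Local Notation tau := (leb (0 : R) T).
Variables (M N Q QT : 'M[R]_n).

Lemma mild_ae xi u v t : {ae tau, forall s, u s = v s} ->
  mild T M N xi u t = mild T M N xi v t.
Proof.
move=> uv; rewrite /mild; congr (_ + _); apply: kop_ae.
by apply: filterS uv => s ->.
Qed.

Lemma mild_cost_ae xi u v : {ae tau, forall s, u s = v s} ->
  mild_cost T M N Q QT xi u = mild_cost T M N Q QT xi v.
Proof.
move=> uv; rewrite /mild_cost (mild_ae _ _ uv); congr (_ + _).
by apply: ae_eq_Rintegral; apply: filterS (uv) => s us; rewrite (mild_ae _ _ uv) us.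
Qed.

Lemma mild_costZ k w : vl2 tau w ->
  mild_cost T M N Q QT 0 (fun s => k *: w s) = k ^+ 2 * mild_cost T M N Q QT 0 w.
Proof.
move=> w2; have mZ t : mild T M N 0 (fun s => k *: w s) t = k *: mild T M N 0 w t.
  by rewrite -mildZ// scaler0.
have m2 := mild_vl2 M N 0 w2.
rewrite /mild_cost mulrDr; congr (_ + _); last first.
  by rewrite mZ -scalemxAr dotZl dotZr; ring.
rewrite -RintegralZl//; last first.
  by apply: integD; apply: integ_dot => //; exact: vl2_mx.
by apply: eq_Rintegral => t _; rewrite mZ -scalemxAr !dotZl !dotZr; ring.
Qed.

Lemma mild_cost_ge0 w : (forall e : 'cV[R]_n, 0 <= dot e (Q *m e)) ->
  (forall e : 'cV[R]_n, 0 <= dot e (QT *m e)) -> 0 <= mild_cost T M N Q QT 0 w.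
Proof.
move=> Q0 QT0; rewrite addr_ge0//; apply: Rintegral_ge0 => t _.
by rewrite addr_ge0// dot_ge0.
Qed.

Lemma minimizes_mxP xi u : minimizes_mx T M N Q QT xi u <->
  vl2 tau u /\ forall u', vl2 tau u' ->
    mild_cost T M N Q QT xi u <= mild_cost T M N Q QT xi u'.
Proof.
split=> [[/L2tP u2 [x /(state_mxP T_ge0 M N xi x u2) xE xmin]]|[u2 umin]].
  split=> // u' u2'; rewrite -(cost_mxE T_ge0 Q QT xE).
  rewrite -(@cost_mxE _ _ _ T_ge0 M N Q QT xi u' (mild T M N xi u'))//.
  by apply: xmin; [exact/L2tP|exact/state_mxP].
split; first exact/L2tP.
exists (mild T M N xi u); first exact/state_mxP.
move=> u' x' /L2tP u2' /(state_mxP T_ge0 M N xi x' u2') xE'.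
rewrite (cost_mxE T_ge0 Q QT xE') (@cost_mxE _ _ _ T_ge0 M N Q QT xi u _ _)//.
exact: umin.
Qed.

Lemma gradient0_minimizes xi u : (forall e : 'cV[R]_n, 0 <= dot e (Q *m e)) ->
  (forall e : 'cV[R]_n, 0 <= dot e (QT *m e)) -> vl2 tau u ->
  \int[tau]_s dot (gradient T M N Q QT xi u s) (gradient T M N Q QT xi u s) = 0 ->
  minimizes_mx T M N Q QT xi u.
Proof.
move=> Q0 QT0 u2 G0; apply/minimizes_mxP; split=> // u' u2'.
have w2 := vl2B u2' u2.
have -> : u' = (fun s => u s + (u' s - u s)).
  by apply/funext => s; rewrite addrC subrK.
rewrite mild_costD// (vl2_CS0 w2 (gradient_vl2 M N Q QT xi u2) G0) addr0.
by rewrite lerDl mild_cost_ge0.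
Qed.

Section Family.
Variables (xi : R -> 'cV[R]_n) (ub : R -> R -> 'cV[R]_n).
Local Notation m1 := (leb (0 : R) 1).
Hypotheses (xi2 : vl2 m1 xi) (ub2 : jl2 tau m1 ub).
Local Notation xb := (fun t g => mild T M N (xi g) (fun s => ub s g) t).

Lemma jmild_jl2 : jl2 tau m1 xb.
Proof.
have t2 := jl2_tensor tau (bmx_expmxT T M) xi2.
have k2 := jkop_jl2 tau (kernel_duhamel T M N 0) ub2.
exact: (vl2D t2 k2).
Qed.

Lemma jmild_vl2 t : vl2 m1 (xb t).
Proof.
apply: vl2D; first exact: vl2_mx.
apply: jkop_vl2 => //; exact/kernel_bmx/kernel_duhamel.
Qed.

Let integ_running : integ (tau \x m1)%E (fun p =>
  dot (xb p.1 p.2) (Q *m xb p.1 p.2) + dot (ub p.1 p.2) (ub p.1 p.2)).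
Proof.
apply: integD; apply: integ_dot => //; [exact: jmild_jl2|].
by apply: vl2_mx; exact: jmild_jl2.
Qed.

Lemma integ_mild_cost :
  integ m1 (fun g => mild_cost T M N Q QT (xi g) (fun s => ub s g)).
Proof.
apply: integD; first exact: (integ_fubini2 integ_running).
by apply: integ_dot; [|apply: vl2_mx]; exact: jmild_vl2.
Qed.

Lemma integral_mild_cost :
  \int[m1]_g mild_cost T M N Q QT (xi g) (fun s => ub s g) =
  \int[tau]_t \int[m1]_g (dot (xb t g) (Q *m xb t g) + dot (ub t g) (ub t g)) +
  \int[m1]_g dot (xb T g) (QT *m xb T g).
Proof.
rewrite (Rfubini integ_running) -RintegralD//; first exact: (integ_fubini2 integ_running).
by apply: integ_dot; [|apply: vl2_mx]; exact: jmild_vl2.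
Qed.

Lemma jgradient_jl2 :
  jl2 tau m1 (fun s g => gradient T M N Q QT (xi g) (fun s => ub s g) s).
Proof.
apply: vl2D; first exact: vl2Z.
apply: vl2D.
  have x2 : jl2 tau m1 (fun t g => (Q + Q^T) *m xb t g).
    by apply: vl2_mx; exact: jmild_jl2.
  exact: (jkop_jl2 tau (kernel_duhamel_tr T M N) x2).
have xT2 : vl2 m1 (fun g => (QT + QT^T) *m xb T g).
  by apply: vl2_mx; exact: jmild_vl2.
have bm : @bmx _ (measurableTypeR R) R n n (fun s => (duhamel T M N 0 T s)^T).
  exact/bmx_tr/kernel_bmx/kernel_duhamel.
exact: (jl2_tensor tau bm xT2).
Qed.

End Family.

End CostFunctional.

(** * Splitting the cost and decoupling the minimizations *)

Section Equivalence.
Context (R : realType) (T : R) (S : set (R -> R)) (d : nat) (f : 'I_d -> R -> R).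
Hypotheses (T_ge0 : 0 <= T) (S_sub : L2_subspace S) (f_onb : orthonormal_basis S f).
Context (n : nat) (c : R) (A B Q QT : R -> R -> R)
  (La Da Lb Db Lq Dq LqT DqT : 'M[R]_n).
Hypotheses (gA : graphon c A) (gB : graphon c B) (gQ : graphon c Q)
  (gQT : graphon c QT)
  (Q_nneg : non_negative (vop Lq Dq Q)) (QT_nneg : non_negative (vop LqT DqT QT))
  (SA : invariant_under S A) (SB : invariant_under S B)
  (SQ : invariant_under S Q) (SQT : invariant_under S QT)
  (perp0 : forall v, orthogonal_complement S v ->
     [/\ {ae leb (0 : R) 1, forall a, gop A v a = 0},
         {ae leb (0 : R) 1, forall a, gop B v a = 0},
         {ae leb (0 : R) 1, forall a, gop Q v a = 0} &
         {ae leb (0 : R) 1, forall a, gop QT v a = 0}]).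
Context (x0 : R -> 'cV[R]_n).
Hypothesis x02 : vl2 (leb (0 : R) 1) x0.
Local Notation m1 := (leb (0 : R) 1).
Local Notation tau := (leb (0 : R) T).
Local Notation Mp := (proj_op f A La Da).
Local Notation Np := (proj_op f B Lb Db).
Local Notation Qp := (proj_op f Q Lq Dq).
Local Notation QTp := (proj_op f QT LqT DqT).
Local Notation opA := (vop La Da A).
Local Notation opB := (vop Lb Db B).
Local Notation opQ := (vop Lq Dq Q).
Local Notation opQT := (vop LqT DqT QT).
Local Notation xip := (Projf f x0).
Local Notation xib := (residual f x0).
Local Notation costp := (mild_cost T Mp Np Qp QTp xip).
Local Notation costb := (fun (w : R -> R -> 'cV[R]_n) g =>
  mild_cost T La Lb Lq LqT (xib g) (fun s => w s g)).
Implicit Types (u w x : R -> R -> 'cV[R]_n).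

Definition control_split u w := [/\ jl2 tau m1 u, jl2 tau m1 w &
  {ae tau, forall t, breve_part S (u t) (w t)}].

Let xib2 : vl2 m1 xib.
Proof. by have [] := residual_vperp S_sub f_onb x02. Qed.

Let state_splitP u w x : control_split u w ->
  state_op T opA opB x0 u x <-> forall t, 0 <= t <= T ->
    split_as f (x t) (mild T Mp Np xip (fun t => Projf f (u t)) t)
      (fun g => mild T La Lb (xib g) (fun s => w s g) t).
Proof.
move=> [u2 w2 uw]; apply: (state_opP T_ge0 S_sub f_onb La Da Lb Db gA gB SA SB) => //.
  by move=> h /perp0[].
by move=> h /perp0[].
Qed.

Let Q0 h : orthogonal_complement S h -> {ae m1, forall a, gop Q h a = 0}.
Proof. by move=> /perp0[]. Qed.

Let QT0 h : orthogonal_complement S h -> {ae m1, forall a, gop QT h a = 0}.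
Proof. by move=> /perp0[]. Qed.

Lemma cost_split u w x : control_split u w -> state_op T opA opB x0 u x ->
  cost_op T opQ opQT u x =
  costp (fun t => Projf f (u t)) + \int[m1]_g costb w g.
Proof.
move=> uw /(state_splitP x uw) xs; have [u2 w2 uwb] := uw.
have up2 := Projf_vl2 S_sub f_onb u2.
have x_vl2 t := jmild_vl2 La Lb xib2 w2 t.
rewrite /cost_op -Rintegral_leb.
have TT : 0 <= T <= T by rewrite T_ge0 lexx.
have sT := xs _ TT.
have E1 := ipv_split S_sub f_onb sT (split_vop S_sub f_onb LqT DqT gQT SQT QT0 sT).
rewrite (integral_mild_cost La Lb Lq LqT xib2 w2) /mild_cost addrACA.
congr (_ + _); last exact: E1.
have x2p := mild_vl2 Mp Np xip up2.
have jx2 := jmild_jl2 La Lb xib2 w2.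
rewrite -RintegralD//; last 2 first.
- by apply: integD; apply: integ_dot => //; exact: vl2_mx.
- apply: (@integ_fubini1 _ _ _ _ R tau m1 (fun p =>
    dot (mild T La Lb (xib p.2) (fun s => w s p.2) p.1)
      (Lq *m mild T La Lb (xib p.2) (fun s => w s p.2) p.1) +
    dot (w p.1 p.2) (w p.1 p.2))).
  by apply: integD; apply: integ_dot => //; exact: vl2_mx.
(* The left integrand contains the given state, whose measurability in t is unknown; agreement for
   almost every t is enough. *)
apply: ae_eq_Rintegral.
apply: filterS2 (leb_ae_in 0 T)
  (filterI (ae_split_control S_sub f_onb u2 uwb) (jl2_ae1 w2)) => t tT [us w2t].
have st := xs _ tT.
rewrite RintegralD; first last.
- exact: integ_dot.
- by apply: integ_dot; [|apply: vl2_mx]; exact: x_vl2.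
- exact: measurableT.
rewrite addrACA; congr (_ + _).
  exact: (ipv_split S_sub f_onb st (split_vop S_sub f_onb Lq Dq gQ SQ Q0 st)).
exact: (ipv_split S_sub f_onb us us).
Qed.

Lemma mild_vperp w t : jl2 tau m1 w -> {ae tau, forall s, vperp f (w s)} ->
  vperp f (fun g => mild T La Lb (xib g) (fun s => w s g) t).
Proof.
move=> w2 wp; apply: (vperpD S_sub f_onb).
  exact: (vperpM S_sub f_onb _ (residual_vperp S_sub f_onb x02)).
by apply: (jkop_vperp S_sub f_onb) => //; exact/kernel_bmx/kernel_duhamel.
Qed.

(** The gradient arises from [w] and the initial residual by constant matrices and integration in
    time, uniformly in gamma, and these operations preserve (S^perp)^n. Moving along the gradient
    therefore leaves the S-component of the control unchanged. *)
Lemma gradient_vperp w : jl2 tau m1 w -> {ae tau, forall s, vperp f (w s)} ->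
  {ae tau, forall s,
    vperp f (fun g => gradient T La Lb Lq LqT (xib g) (fun t => w t g) s)}.
Proof.
move=> w2 wp; apply: filterS (wp) => s ws.
apply: (vperpD S_sub f_onb); first exact: (vperpZ S_sub f_onb).
apply: (vperpD S_sub f_onb); last first.
  by do 2 apply: (vperpM S_sub f_onb); exact: mild_vperp.
have Hx2 : jl2 tau m1 (fun t g =>
    (Lq + Lq^T) *m mild T La Lb (xib g) (fun s => w s g) t).
  by apply: vl2_mx; exact: jmild_jl2.
have bK : @bmx _ (measurableTypeR R) R n n (fun t => (duhamel T La Lb 0 t s)^T).
  exact: (kernel_bmx (X0 := measurableTypeR R) s (kernel_duhamel_tr T La Lb)).
apply: (jkop_vperp S_sub f_onb bK Hx2).
by apply: nearW => t; apply: (vperpM S_sub f_onb); exact: mild_vperp.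
Qed.

Lemma state_exists u w : control_split u w ->
  exists x, state_op T opA opB x0 u x.
Proof.
move=> uw; have [u2 w2 uwb] := uw.
exists (fun t g => Slift f (mild T Mp Np xip (fun t => Projf f (u t)) t) g +
  mild T La Lb (xib g) (fun s => w s g) t).
apply/(state_splitP _ uw) => t _.
have wp : vperp f (fun g => mild T La Lb (xib g) (fun s => w s g) t).
  apply: mild_vperp => //.
  by apply: filterS (ae_split_control S_sub f_onb u2 uwb) => s [].
split=> //; last exact: nearW.
by apply: vl2D; [exact: (lift_vl2 S_sub f_onb)|case: wp].
Qed.

Lemma minimizes_opP u w : control_split u w ->
  minimizes_op T opA opB opQ opQT x0 u <->
  forall u' w', control_split u' w' ->
    costp (fun t => Projf f (u t)) + \int[m1]_g costb w g <=
    costp (fun t => Projf f (u' t)) + \int[m1]_g costb w' g.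
Proof.
move=> uw; have [u2 w2 uwb] := uw; split.
  move=> [_ [x xs xmin]] u' w' uw'; have [u2' _ _] := uw'.
  have [x' xs'] := state_exists uw'.
  have := xmin u' x' ((L2tvP _ _).2 u2') xs'.
  by rewrite (cost_split uw xs) (cost_split uw' xs').
move=> umin; split; first exact/L2tvP.
have [x xs] := state_exists uw; exists x; first exact: xs.
move=> u' x' /L2tvP u2' xs'.
(* A competitor comes without a chosen complement part; its residual is one, jointly measurable in
   time and gamma. *)
have uw' : control_split u' (fun t g => residual f (u' t) g).
  split=> //.
    have lj : jl2 tau m1 (fun t g => Slift f (Projf f (u' t)) g).
      move=> i; under eq_fun do rewrite mxE; apply: l2_sum => l.
      exact: (l2_tensor (Projf_vl2 S_sub f_onb u2' _) (onb_l2 S_sub f_onb l)).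
    have := vl2B u2' lj; rewrite /jl2.
    by under [X in _ -> vl2 _ X]eq_fun do rewrite residualE.
  apply: filterS (jl2_ae1 u2') => t ut; apply/(breve_partP S_sub f_onb _ ut).
  by split; [case: (residual_vperp S_sub f_onb ut)|exact: nearW].
by rewrite (cost_split uw xs) (cost_split uw' xs'); exact: umin.
Qed.

(** The two components of a control can be prescribed independently, which is what allows one of
    them to be varied with the other held fixed. *)
Lemma control_split_lift (k : R -> 'cV[R]_(d * n)) w : vl2 tau k ->
  jl2 tau m1 w -> {ae tau, forall t, vperp f (w t)} ->
  control_split (fun t g => Slift f (k t) g + w t g) w /\
  {ae tau, forall t, Projf f (fun g => Slift f (k t) g + w t g) = k t}.
Proof.
move=> k2 w2 wp.
have lj : jl2 tau m1 (fun t g => Slift f (k t) g).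
  move=> i; under eq_fun do rewrite mxE; apply: l2_sum => l.
  exact: (l2_tensor (k2 _) (onb_l2 S_sub f_onb l)).
have u2 : jl2 tau m1 (fun t g => Slift f (k t) g + w t g) by exact: vl2D.
have us : {ae tau, forall t,
    split_as f (fun g => Slift f (k t) g + w t g) (k t) (w t)}.
  by apply: filterS2 (jl2_ae1 u2) wp => t ut wt; split=> //; exact: nearW.
split; last by apply: filterS us => t; exact: (split_Projf S_sub f_onb).
split=> //; apply: filterS us => t ut; have [v2 [wt2 _] _] := ut.
apply/(breve_partP S_sub f_onb _ v2); split=> //.
by apply: filterS (split_residual S_sub f_onb ut) => g ->.
Qed.

(* The controls of almost every point are optimal because the global control
   can be perturbed along the gradient itself, which is jointly measurable and
   takes values in the complement of S; no measurable selection is needed. *)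
Lemma minimizes_equiv u w : control_split u w ->
  minimizes_op T opA opB opQ opQT x0 u <->
  minimizes_mx T Mp Np Qp QTp xip (fun t => Projf f (u t)) /\
  {ae m1, forall g, minimizes_mx T La Lb Lq LqT (xib g) (fun t => w t g)}.
Proof.
move=> uw; have [u2 w2 uwb] := uw; have up2 := Projf_vl2 S_sub f_onb u2.
have wp : {ae tau, forall t, vperp f (w t)}.
  by apply: filterS (ae_split_control S_sub f_onb u2 uwb) => t [].
rewrite (minimizes_opP uw); split=> [umin|[pmin bmin] u' w' uw']; last first.
  have [u2' w2' _] := uw'; apply: lerD.
    have [_ h] := (minimizes_mxP T_ge0 _ _ _ _ _ _).1 pmin.
    by apply: h; exact: (Projf_vl2 S_sub f_onb u2').
  apply: ae_le_Rintegral; [exact: integ_mild_cost|exact: integ_mild_cost|].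
  apply: filterS2 bmin (jl2_ae2 w2') => g gmin wg.
  have [_ h] := (minimizes_mxP T_ge0 _ _ _ _ _ _).1 gmin.
  exact: h.
split.
  apply/(minimizes_mxP T_ge0); split=> // k k2.
  (* The competitor keeps the complement part [w], whose cost then cancels from the comparison. *)
  have [kw kE] := control_split_lift k2 w2 wp.
  have := umin _ _ kw; rewrite lerD2r => /le_trans; apply.
  by rewrite (mild_cost_ae _ _ _ _ _ kE).
pose G s g := gradient T La Lb Lq LqT (xib g) (fun t => w t g) s.
have G2 : jl2 tau m1 G by exact: jgradient_jl2.
have Gp : {ae tau, forall t, vperp f (G t)}.
  exact: gradient_vperp.
pose I1 := \int[m1]_g \int[tau]_s dot (G s g) (G s g).
pose I2 := \int[m1]_g mild_cost T La Lb Lq LqT 0 (fun s => G s g).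
have GG := integ_dot G2 G2.
have i1 : integ m1 (fun g => \int[tau]_s dot (G s g) (G s g)).
  exact: (integ_fubini2 GG).
have i2 : integ m1 (fun g => mild_cost T La Lb Lq LqT 0 (fun s => G s g)).
  by apply: (@integ_mild_cost _ T n La Lb Lq LqT (fun=> 0) G) => //; exact: vl20.
(* The cost difference along -e G. The expansion is exact, so the inequality holds for every real
   e. *)
have perturb e : 0 <= e ^+ 2 * I2 - e * I1.
  have wG2 : jl2 tau m1 (fun s g => w s g + (- e) *: G s g).
    by apply: vl2D => //; exact: vl2Z.
  have wGp : {ae tau, forall t, vperp f (fun g => w t g + (- e) *: G t g)}.
    apply: filterS2 wp Gp => t wt Gt; apply: (vperpD S_sub f_onb) => //.
    exact: (vperpZ S_sub f_onb).
  have [kw kE] := control_split_lift up2 wG2 wGp.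
  have := umin _ _ kw; rewrite (mild_cost_ae _ _ _ _ _ kE) lerD2l.
  have -> : \int[m1]_g costb (fun s g => w s g + (- e) *: G s g) g =
      \int[m1]_g costb w g + (e ^+ 2 * I2 - e * I1).
    have wi := integ_mild_cost La Lb Lq LqT xib2 w2.
    rewrite -!RintegralZl// -RintegralB//; try exact: integZ.
    rewrite -RintegralD//; last by apply: integB; exact: integZ.
    apply: ae_eq_Rintegral; apply: filterS2 (jl2_ae2 w2) (jl2_ae2 G2) => g wg Gg.
    rewrite mild_costD//; last exact: vl2Z.
    have EG : \int[tau]_s dot (- e *: G s g) (G s g) =
        - (e * \int[tau]_s dot (G s g) (G s g)).
      under eq_Rintegral do rewrite dotZl.
      by rewrite RintegralZl; [rewrite mulNr|exact: measurableT|exact: integ_dot].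
    rewrite mild_costZ// sqrrN -addrA; congr (_ + _).
    by rewrite addrC; congr (_ + _); exact: EG.
  by rewrite lerDl.
have I1_0 : I1 = 0.
  apply/eqP; rewrite eq_le; apply/andP; split; last first.
    by apply: Rintegral_ge0 => g _; apply: Rintegral_ge0 => s _; exact: dot_ge0.
  rewrite leNgt; apply/negP => I1_gt0.
  have I2_gt0 : 0 < I2 by have := perturb 1; nra.
  (* The minimizer of e^2 I2 - e I1, where the value is -I1^2 / (4 I2) < 0. The case e = 1 has just
     given I2 >= I1 > 0. *)
  have := perturb (I1 / (2 * I2)).
  have -> : (I1 / (2 * I2)) ^+ 2 * I2 - I1 / (2 * I2) * I1 = - (I1 ^+ 2 / (4 * I2)).
    by field; rewrite gt_eqF.
  by rewrite oppr_ge0 leNgt divr_gt0// ?exprn_gt0// mulr_gt0.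
have G0 : {ae m1, forall g, \int[tau]_s dot (G s g) (G s g) = 0}.
  apply: Rintegral_eq0_ae => // g.
  by apply: Rintegral_ge0 => s _; exact: dot_ge0.
apply: filterS2 (jl2_ae2 w2) G0 => g wg Gg0.
apply: gradient0_minimizes => //.
  exact: (non_negative_const gQ Q_nneg).
exact: (non_negative_const gQT QT_nneg).
Qed.

End Equivalence.

Theorem proposition4 (R : realType) (T c : R) (n : nat)
  (T_gt0 : 0 < T) (c_gt0 : 0 < c) (n_ge1 : (1 <= n)%N)
  (La Da Lb Db Lq Dq LqT DqT : 'M[R]_n)
  (A B Q QT : R -> R -> R)
  (gA : graphon c A) (gB : graphon c B) (gQ : graphon c Q) (gQT : graphon c QT)
  (Q_sa : self_adjoint (vop Lq Dq Q)) (Q_nneg : non_negative (vop Lq Dq Q))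
  (QT_sa : self_adjoint (vop LqT DqT QT))
  (QT_nneg : non_negative (vop LqT DqT QT))
  (S : set (R -> R)) (S_sub : L2_subspace S)
  (SA : invariant_under S A) (SB : invariant_under S B)
  (SQ : invariant_under S Q) (SQT : invariant_under S QT)
  (perp0 : forall v, orthogonal_complement S v ->
     [/\ {ae leb 0 1, forall a, gop A v a = 0},
         {ae leb 0 1, forall a, gop B v a = 0},
         {ae leb 0 1, forall a, gop Q v a = 0} &
         {ae leb 0 1, forall a, gop QT v a = 0}])
  (d : nat) (f : 'I_d -> R -> R) (f_onb : orthonormal_basis S f)
  (x0 : R -> 'cV[R]_n) (x0_L2 : L2v x0)
  (u : R -> R -> 'cV[R]_n) (u_L2 : L2tv T u)
  (ub : R -> R -> 'cV[R]_n) (ub_L2 : L2tv T ub)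
  (ub_breve : {ae leb 0 T, forall t, breve_part S (u t) (ub t)}) :
  let I := 1%:M : 'M[R]_d in
  let Mp := I *t La + gmat f A *t Da in
  let Np := I *t Lb + gmat f B *t Db in
  let up := fun t => Projf f (u t) in
  (forall x : R -> R -> 'cV[R]_n,
     (forall t, 0 <= t <= T -> L2v (x t)) ->
     (state_op T (vop La Da A) (vop Lb Db B) x0 u x <->
      state_mx T Mp Np (Projf f x0) up (fun t => Projf f (x t)) /\
      exists xb : R -> R -> 'cV[R]_n,
        [/\ L2tv T xb,
            forall t, 0 <= t <= T -> breve_part S (x t) (xb t) &
            {ae leb 0 1, forall g, state_mx T La Lb (residual f x0 g)
               (fun t => ub t g) (fun t => xb t g)}])) /\
  (minimizes_op T (vop La Da A) (vop Lb Db B) (vop Lq Dq Q) (vop LqT DqT QT)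
     x0 u <->
   minimizes_mx T Mp Np (I *t Lq + gmat f Q *t Dq) (I *t LqT + gmat f QT *t DqT)
     (Projf f x0) up /\
   {ae leb 0 1, forall g,
      minimizes_mx T La Lb Lq LqT (residual f x0 g) (fun t => ub t g)}).
Proof.
move=> I Mp Np up; have T_ge0 := ltW T_gt0.
have x02 : vl2 (leb 0 1) x0 by exact/L2vP.
have u2 : jl2 (leb 0 T) (leb 0 1) u by exact/L2tvP.
have ub2 : jl2 (leb 0 T) (leb 0 1) ub by exact/L2tvP.
have uw : control_split T S u ub by [].
have up2 := Projf_vl2 S_sub f_onb u2.
split; last first.
  exact: (minimizes_equiv T_ge0 S_sub f_onb La Da Lb Db gA gB gQ gQT
    Q_nneg QT_nneg SA SB SQ SQT perp0 x02 uw).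
move=> x xL2; have x2 t : 0 <= t <= T -> vl2 (leb 0 1) (x t) by move=> /xL2/L2vP.
have AB0 h : orthogonal_complement S h ->
    {ae leb 0 1, forall a, gop A h a = 0} /\ {ae leb 0 1, forall a, gop B h a = 0}.
  by move=> /perp0[].
have stP := state_opP T_ge0 S_sub f_onb La Da Lb Db gA gB SA SB
  (fun h hS => (AB0 h hS).1) (fun h hS => (AB0 h hS).2) u2 ub2 ub_breve x x02.
have xib2 : vl2 (leb 0 1) (residual f x0).
  by have [] := residual_vperp S_sub f_onb x02.
split=> [/stP xs|[xp [xb [xb2 xbb xbs]]]].
  split.
    apply/(state_mxP T_ge0) => // t tT; exact: (split_Projf S_sub f_onb (xs t tT)).
  (* The residual of [x t] would not do: [x] is not known to be jointly measurable, while the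
     explicit solution is, and it satisfies the equation at all times outside one null set of
     gamma. *)
  exists (fun t g => mild T La Lb (residual f x0 g) (fun s => ub s g) t); split.
  - apply/L2tvP; exact: jmild_jl2.
  - move=> t tT; apply/(breve_partP S_sub f_onb _ (x2 t tT)); split.
      exact: jmild_vl2.
    by apply: filterS (split_residual S_sub f_onb (xs t tT)) => g ->.
  - by apply: filterS (jl2_ae2 ub2) => g ug; apply/(state_mxP T_ge0).
apply/stP => t tT.
have -> : mild T (proj_op f A La Da) (proj_op f B Lb Db) (Projf f x0)
    (fun t => Projf f (u t)) t = Projf f (x t).
  by rewrite ((state_mxP T_ge0 _ _ _ _ up2).1 xp t tT).
apply: (split_aer _ _ (split_canon S_sub f_onb (x2 t tT))).
  exact: (jmild_vl2 La Lb xib2 ub2 t).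
have [_ wr] := (breve_partP S_sub f_onb _ (x2 t tT)).1 (xbb t tT).
(* At the fixed time t, [xb t] is the residual of [x t] for almost every gamma, and by its own
   equation it is the explicit solution for almost every gamma. *)
apply: filterS2 (filterI wr (jl2_ae2 ub2)) xbs => g [<- ug] xg.
by rewrite ((state_mxP T_ge0 _ _ _ _ ug).1 xg t tT).
Qed.
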